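(* Let $(R,\mathfrak m)$ be a Cohen-Macaulay local ring of dimension $d\ge1$ with infinite residue field, and let $I_1,I_2$ be $\mathfrak m$-primary ideals. Then $I_2$ has minimal multiplicity with respect to $I_1$ if and only if for some minimal reduction $(x_1,\dots,x_d)$ of $I_2$, $$e_0(I_2)-\ell\!\left(\frac R{I_1I_2}\right)+d\cdot\ell\!\left(\frac R{I_1}\right)=-\sum_{i=2}^d(-1)^i\left[h_i(1,1)-\binom di\ell\!\left(\frac R{I_1}\right)\right].$$ Likewise, $I_2$ has almost minimal multiplicity with respect to $I_1$ if and only if for some minimal reduction $(x_1,\dots,x_d)$ of $I_2$, $$e_0(I_2)-\ell\!\left(\frac R{I_1I_2}\right)+d\cdot\ell\!\left(\frac R{I_1}\right)=1-\sum_{i=2}^d(-1)^i\left[h_i(1,1)-\binom di\ell\!\left(\frac R{I_1}\right)\right].$$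
   Context: $\ell$ denotes length and $e_0(I_2)$ is the multiplicity of $I_2$. $I_2$ has minimal multiplicity (resp. almost minimal multiplicity) with respect to $I_1$ if for some minimal reduction $(x_1,\dots,x_d)$ of $I_2$ one has $\ell\bigl(I_1I_2/I_1(x_1,\dots,x_d)\bigr)=0$ (resp. $=1$). Given $x_1,\dots,x_d\in I_2$, let $C(1,1)$ be the complex $$0\to(R/I_1)^{\binom dd}\to(R/I_1)^{\binom d{d-1}}\to\cdots\to(R/I_1)^{d}\to R/I_1I_2\to0$$ with $R/I_1I_2$ in degree $0$ and $(R/I_1)^{\binom di}$ in degree $i$ for $1\le i\le d$, whose differentials are induced by those of the Koszul complex $K_\bullet(x_1,\dots,x_d;R)$. Put $h_i(1,1):=\ell(H_i(C(1,1)))$. *)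

(* Defs.v *)
From mathcomp Require Import all_boot all_order all_algebra.
From mathcomp Require Import all_classical topology normedtype.
Import Order.TTheory GRing.Theory Num.Theory numFieldNormedType.Exports.

Set Implicit Arguments.
Unset Strict Implicit.
Unset Printing Implicit Defensive.

Local Open Scope classical_set_scope.
Local Open Scope ring_scope.

Section Chains.
Variables (T : Type) (P : set (set T)).

Definition strict_chain (n : nat) : Prop :=
  exists c : nat -> set T,
    (forall i, (i <= n)%N -> P (c i)) /\
    (forall i, (i < n)%N -> c i `<` c i.+1).

Definition max_chain (n : nat) : Prop :=
  strict_chain n /\ forall k, strict_chain k -> (k <= n)%N.

End Chains.

Section Modules.
Variables (R : comNzRingType) (M : lmodType R).

Definition submodule (N : set M) : Prop :=
  [/\ N 0, forall a b, N a -> N b -> N (a + b)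
    & forall (r : R) a, N a -> N (r *: a)].

(* Quotient modules B/A are handled through the pair A `<=` B of submodules of
   M: by the correspondence theorem, chains of submodules of B/A are the chains
   of submodules of M lying between A and B. *)
Definition is_length (A B : set M) (n : nat) : Prop :=
  max_chain [set N : set M | [/\ submodule N, A `<=` N & N `<=` B]] n.

(* Equal to 0 when B/A has infinite length. *)
Definition length (A B : set M) : nat := xget 0%N [set n | is_length A B n].

End Modules.

Section Ideals.
Variable R : comNzRingType.
Implicit Types I J K p m : set R.

Definition ideal I : Prop := submodule (I : set R^o).

Definition ideal_gen (S : set R) : set R := smallest ideal S.

Definition idealM I J : set R := ideal_gen [set a * b | a in I & b in J].

Definition idealX I (n : nat) : set R := iter n (idealM I) setT.

Definition noetherian : Prop :=
  forall I, ideal I -> exists s : seq R, I = ideal_gen [set` s].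

Definition prime_ideal p : Prop :=
  [/\ ideal p, p <> setT & forall a b, p (a * b) -> p a \/ p b].

Definition maximal_ideal m : Prop :=
  [/\ ideal m, m <> setT
    & forall I, ideal I -> m `<=` I -> I = m \/ I = setT].

Definition is_local m : Prop :=
  maximal_ideal m /\ forall I, maximal_ideal I -> I = m.

(* The set of cosets of m, i.e. the underlying set of R/m, is infinite. *)
Definition infinite_residue_field m : Prop :=
  infinite_set (range (fun a : R => [set b | m (b - a)])).

Definition radical I : set R := [set a | exists n, I (a ^+ n)].

Definition primary_ideal I : Prop :=
  [/\ ideal I, I <> setT & forall a b, I (a * b) -> I a \/ radical I b].

Definition is_primary_to m I : Prop := primary_ideal I /\ radical I = m.

Definition krull_dim (d : nat) : Prop := max_chain prime_ideal d.

Definition regular_seq (s : seq R) : Prop :=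
  ideal_gen [set` s] <> setT /\
  forall i, (i < size s)%N -> forall a,
    ideal_gen [set` take i s] (s`_i * a) -> ideal_gen [set` take i s] a.

Definition is_depth m (n : nat) : Prop :=
  (exists s, [/\ regular_seq s, [set` s] `<=` m & size s = n]) /\
  (forall s, regular_seq s -> [set` s] `<=` m -> (size s <= n)%N).

Definition cohen_macaulay m (d : nat) : Prop := krull_dim d /\ is_depth m d.

Definition reduction J I : Prop :=
  [/\ ideal J, J `<=` I & exists n, idealM J (idealX I n) = idealX I n.+1].

Definition minimal_reduction J I : Prop :=
  reduction J I /\ forall K, reduction K I -> K `<=` J -> K = J.

Definition ell I J : nat := length (I : set R^o) (J : set R^o).

(* lim_n d! l(R/I^n) / n^d, for d the Krull dimension of R; the limit is an
   integer, so that it can be taken in rat. *)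
Definition multiplicity (d : nat) I : rat :=
  lim ((fun n : nat => (d`! * ell (idealX I n) setT)%N%:R / n%:R ^+ d : rat^o)
         @ \oo).

Definition minimal_multiplicity (d : nat) (I1 I2 : set R) : Prop :=
  exists2 x : 'I_d -> R, minimal_reduction (ideal_gen (range x)) I2 &
    is_length (idealM I1 (ideal_gen (range x)) : set R^o) (idealM I1 I2) 0.

Definition almost_minimal_multiplicity (d : nat) (I1 I2 : set R) : Prop :=
  exists2 x : 'I_d -> R, minimal_reduction (ideal_gen (range x)) I2 &
    is_length (idealM I1 (ideal_gen (range x)) : set R^o) (idealM I1 I2) 1.

End Ideals.

Section Koszul.
Variables (R : comNzRingType) (d : nat).

(* The exterior algebra of R^d: a is the sum over S of (a S) e_S, where
   e_S = e_{j1} /\ ... /\ e_{ji} for S = {j1 < ... < ji}. *)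
Definition koszul : Type := {ffun {set 'I_d} -> R^o}.

Implicit Types (x : 'I_d -> R) (a : koszul) (I : set R) (i : nat).

Definition koszul_deg i : set koszul :=
  [set a | forall S : {set 'I_d}, #|S| != i -> a S = 0].

(* The R-linear map with e_S |-> \sum_(j in S) (-1)^#{k in S, k < j} x_j e_(S\j);
   the coefficient of e_T in the image of a comes from the S = j |: T. *)
Definition koszul_diff x a : koszul :=
  [ffun T : {set 'I_d} => \sum_(j | j \notin T)
     (-1) ^+ #|[pred k in T | (k < j)%N]| * x j * a (j |: T)].

(* The degree i module of C(1,1) is koszul_deg i / c11_den I1 I2 i. *)
Definition c11_den I1 I2 i : set koszul :=
  koszul_deg i `&`
  [set a | forall S, (if i is 0 then idealM I1 I2 else I1) (a S)].

Definition c11_cycles I1 I2 x i : set koszul :=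
  koszul_deg i `&` [set a | c11_den I1 I2 i.-1 (koszul_diff x a)].

Definition c11_boundaries I1 I2 x i : set koszul :=
  [set koszul_diff x b + c | b in koszul_deg i.+1 & c in c11_den I1 I2 i].

Definition h11 I1 I2 x i : nat :=
  length (c11_boundaries I1 I2 x i) (c11_cycles I1 I2 x i).

End Koszul.

(* Main.v *)
Require Import Defs.
From HB Require Import structures.
From mathcomp Require Import all_boot all_order all_algebra.
From mathcomp Require Import all_classical.
From mathcomp Require Import topology normedtype sequences.
From mathcomp Require Import ring lra.
Import Order.TTheory GRing.Theory Num.Theory.
Import numFieldNormedType.Exports.
Set Implicit Arguments.
Unset Strict Implicit.
Unset Printing Implicit Defensive.
Local Open Scope classical_set_scope.
Local Open Scope ring_scope.

(* Write J = (x_1, ..., x_d) and L for the length of R/I1, and let D_i and B_i be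
   the denominator and the boundaries of C(1,1) in degree i, b_i = l(B_i/D_i).
   Then C(d,i) L = b_(i-1) + h_i + b_i for i >= 2 and b_d = 0, so that the sum of
   the theorem telescopes to -b_1. As J is generated by d elements and its
   radical contains a regular sequence of length d, the Koszul complex of x is
   exact in positive degrees; hence d L - b_1 = l(J/I1 J). Applying the exactness
   to powers of the x_i as well shows that l(R/J^(n+1)) = C(n+d,d) l(R/J), whence
   e_0(I2) = e_0(J) = l(R/J). Altogether, for every x generating a reduction of
   I2, the left-hand side of the theorem minus the negated sum is
   l(I1 I2/I1 J). *)

(** The hypotheses provide some regular sequence y of length d in m; they do not say that x is one.
    Acyclicity of the Koszul complex is therefore derived from a condition on the radical of (x): by
    descending induction along y, H_i(x; R/(y_1, ..., y_k)) vanishes for i > k. Passing to powers of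
    the x_j does not change that radical, so the same argument covers all the powers and shows that
    x_j is regular modulo any powers of the other x_u. From this the colon ideals behind the Hilbert
    function of J are computed by substitution. No quotient is ever formed: statements modulo an
    ideal are expressed through representatives, and lengths through pairs of nested submodules.
    Since [length] is 0 on a quotient of infinite length, additivity needs [fin_length]; this is the
    purpose of the finiteness results for ideals whose radical contains m. *)

Lemma strict_chain_map (T T' : Type) (P : set (set T)) (P' : set (set T'))
    (phi : set T -> set T') n :
  (forall N, P N -> P' (phi N)) ->
  (forall N N', P N -> P N' -> N `<` N' -> phi N `<` phi N') ->
  strict_chain P n -> strict_chain P' n.
Proof.
move=> Pphi ltphi [c [Pc ltc]]; exists (phi \o c); split=> i lein /=.
  by apply: Pphi; apply: Pc.
by apply: ltphi; [apply: Pc (ltnW lein)|apply: Pc|apply: ltc].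
Qed.

Lemma max_chain_bounded (T : Type) (P : set (set T)) n0 :
  (exists N, P N) -> (forall n, strict_chain P n -> (n <= n0)%N) ->
  exists n, max_chain P n.
Proof.
move=> [N PN] bnd.
have ex0 : exists n, `[< strict_chain P n >].
  by exists 0%N; apply/asboolP; exists (fun=> N).
have bnd' n : `[< strict_chain P n >] -> (n <= n0)%N by move/asboolP/bnd.
case: (ex_maxnP ex0 bnd') => n /asboolP chn maxn; exists n; split=> // k chk.
by apply: maxn; apply/asboolP.
Qed.

(** * Lengths of subquotients and their additivity *)

Section Submodules.
Variables (R : comNzRingType) (M : lmodType R).
Implicit Types A B C N X Y : set M.

Lemma submodule0 N : submodule N -> N 0. Proof. by case. Qed.

Lemma submoduleD N a b : submodule N -> N a -> N b -> N (a + b).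
Proof. by case=> _ + _; apply. Qed.

Lemma submoduleZ N r a : submodule N -> N a -> N (r *: a).
Proof. by case=> _ _; apply. Qed.

Lemma submoduleN N a : submodule N -> N a -> N (- a).
Proof. by move=> sN Na; rewrite -scaleN1r; apply: submoduleZ. Qed.

Lemma submoduleB N a b : submodule N -> N a -> N b -> N (a - b).
Proof. by move=> sN Na Nb; apply: submoduleD => //; apply: submoduleN. Qed.

Lemma submodule_sum N (I : Type) (s : seq I) (P : pred I) (F : I -> M) :
  submodule N -> (forall i, P i -> N (F i)) -> N (\sum_(i <- s | P i) F i).
Proof.
move=> sN NF; elim/big_ind: _ => // [|a b Na Nb]; first exact: submodule0.
exact: submoduleD.
Qed.

Lemma submoduleI A B : submodule A -> submodule B -> submodule (A `&` B).
Proof.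
move=> sA sB; split=> [|a b [Aa Ba] [Ab Bb]|r a [Aa Ba]]; split;
  by [apply: submodule0|apply: submoduleD|apply: submoduleZ].
Qed.

Definition smodD A B : set M := [set a + b | a in A & b in B].

Lemma submodule_smodD A B : submodule A -> submodule B -> submodule (smodD A B).
Proof.
move=> sA sB; split=> [|_ _ [a Aa [b Bb <-]] [a' Aa' [b' Bb' <-]]|r _ [a Aa [b Bb <-]]].
- by exists 0; [exact: submodule0|exists 0; [exact: submodule0|rewrite addr0]].
- exists (a + a'); first exact: submoduleD.
  by exists (b + b'); [exact: submoduleD|rewrite addrACA].
- exists (r *: a); first exact: submoduleZ.
  by exists (r *: b); [exact: submoduleZ|rewrite scalerDr].
Qed.

Lemma smodDl A B : submodule B -> A `<=` smodD A B.
Proof. by move=> sB a Aa; exists a => //; exists 0;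
  [exact: submodule0|rewrite addr0]. Qed.

Lemma smodDr A B : submodule A -> B `<=` smodD A B.
Proof. by move=> sA b Bb; exists 0; [exact: submodule0|exists b => //;
  rewrite add0r]. Qed.

Lemma smodD_sub A B C : submodule C -> A `<=` C -> B `<=` C -> smodD A B `<=` C.
Proof.
by move=> sC subAC subBC _ [a Aa [b Bb <-]]; apply: submoduleD; auto.
Qed.

Lemma smodDSS A A' B B' : A `<=` A' -> B `<=` B' -> smodD A B `<=` smodD A' B'.
Proof.
move=> AA' BB' _ [a Aa [b Bb <-]]; exists a; first exact: AA'.
by exists b; first exact: BB'.
Qed.

Definition between A B : set (set M) :=
  [set N | [/\ submodule N, A `<=` N & N `<=` B]].

Lemma strict_chain_between A A' B B' n : A' `<=` A -> B `<=` B' ->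
  strict_chain (between A B) n -> strict_chain (between A' B') n.
Proof.
move=> AA' BB'; apply: (strict_chain_map (phi := id)) => // N [sN AN NB]; split=> //.
  exact: subset_trans AN.
exact: subset_trans BB'.
Qed.

Lemma strict_chainS A X Y n : submodule Y -> A `<=` Y -> X `<` Y ->
  strict_chain (between A X) n -> strict_chain (between A Y) n.+1.
Proof.
move=> sY AY [XY nYX] [c [Pc ltc]].
exists (fun i => if (i <= n)%N then c i else Y); split=> i lein.
  case: ifP => [le_i_n|_]; last by split.
  by have [sN AN NX] := Pc i le_i_n; split=> //; apply: subset_trans XY.
have [lt_i_n|] := ltnP i n; first by rewrite (ltnW lt_i_n); apply: ltc.
move=> le_n_i; have {lein le_n_i}-> : i = n by apply/eqP; rewrite eqn_leq -ltnS lein.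
rewrite leqnn; have [_ _ cX] := Pc n (leqnn n); split.
  exact: subset_trans XY.
by move=> Yc; apply: nYX; apply: subset_trans cX.
Qed.

Lemma strict_chain_cat A B C p q : A `<=` B -> B `<=` C ->
  strict_chain (between A B) p -> strict_chain (between B C) q ->
  strict_chain (between A C) (p + q)%N.
Proof.
move=> AB BC [c [Pc ltc]] [c' [Pc' ltc']].
exists (fun i => if (i <= p)%N then c i else c' (i - p)%N); split=> i lei.
  case: leqP => [leip|ltpi].
    by have [sN AN NB] := Pc i leip; split=> //; apply: subset_trans BC.
  have [|sN BN NC] := Pc' (i - p)%N; first by rewrite leq_subLR.
  by split=> //; apply: subset_trans BN.
case: (ltngtP i p) => [ltip|ltpi|eq_ip]; first exact: ltc.
  by rewrite subSn ?(ltnW ltpi) //; apply: ltc'; rewrite ltn_subLR // ltnW.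
move: lei; rewrite eq_ip -[X in (X < _)%N]addn0 ltn_add2l subSnn => q_gt0.
have [_ _ cB] := Pc p (leqnn p); have [_ Bc _] := Pc' 0%N isT.
have [c01 nc10] := ltc' 0%N q_gt0; split.
  by apply: subset_trans c01; apply: subset_trans Bc.
by move=> c'c; apply: nc10; apply: subset_trans Bc; apply: subset_trans cB.
Qed.

(* By the modular law, a strict inclusion N < N' stays strict after
   intersecting with B or after adding B. *)
Lemma strict_chain_split A B C k : submodule B -> A `<=` B ->
  strict_chain (between A C) k ->
  exists p q, [/\ (k <= p + q)%N, strict_chain (between A (C `&` B)) p
    & strict_chain (between B (smodD C B)) q].
Proof.
move=> sB AB [c [Pc ltc]].
suff H i : (i <= k)%N -> exists p q, [/\ (i <= p + q)%N,
    strict_chain (between A (c i `&` B)) p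
    & strict_chain (between B (smodD (c i) B)) q].
  have [p [q [le_k cp cq]]] := H k (leqnn k); have [_ _ ckC] := Pc k (leqnn k).
  exists p, q; split=> //.
    by apply: strict_chain_between cp => //; apply: setSI.
  by apply: strict_chain_between cq => //; apply: smodDSS.
elim: i => [|i IHi] ltik.
  have [s0 A0 _] := Pc 0%N isT.
  exists 0%N, 0%N; split=> //.
    exists (fun=> c 0%N `&` B); split=> // _ _; split=> //.
      exact: submoduleI.
    by move=> a Aa; split; [exact: A0|exact: AB].
  exists (fun=> B); split=> // _ _; split=> //; exact: smodDr.
have [p [q [lei chp chq]]] := IHi (ltnW ltik).
have [sX AX _] := Pc i (ltnW ltik); have [sY AY _] := Pc i.+1 ltik.
have [XY nYX] := ltc i ltik.
have XBYB : c i `&` B `<=` c i.+1 `&` B by apply: setSI.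
have XDYD : smodD (c i) B `<=` smodD (c i.+1) B by apply: smodDSS.
have [YBXB|nYBXB] := pselect (c i.+1 `&` B `<=` c i `&` B); last first.
  exists p.+1, q; split; first by rewrite addSn ltnS.
    apply: strict_chainS chp; [exact: submoduleI| |by split].
    by move=> a Aa; split; [exact: AY|exact: AB].
  exact: strict_chain_between chq.
exists p, q.+1; split; first by rewrite addnS ltnS.
  exact: strict_chain_between chp.
apply: strict_chainS chq; [exact: submodule_smodD|exact: smodDr|split=> // YDXD].
apply: nYX => y Yy.
have /YDXD[a Xa [b Bb eqy]] : smodD (c i.+1) B y by apply: smodDl.
have [|Xb _] := YBXB b; last by rewrite -eqy; apply: submoduleD.
split=> //; suff -> : b = y - a by apply: submoduleB => //; apply: XY.
by rewrite -eqy addrC addKr.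
Qed.

Definition fin_length A B : Prop := exists n, is_length A B n.

Lemma is_length_uniq A B n k : is_length A B n -> is_length A B k -> n = k.
Proof.
move=> [cn maxn] [ck maxk]; apply/eqP.
by rewrite eqn_leq maxk // maxn.
Qed.

Lemma is_length_length A B n : is_length A B n -> length A B = n.
Proof.
rewrite /length => ln; case: xgetP => [k _ lk|/(_ n)//].
exact: is_length_uniq lk ln.
Qed.

Lemma fin_lengthP A B : fin_length A B -> is_length A B (length A B).
Proof. by case=> n ln; rewrite (is_length_length ln). Qed.

Lemma fin_length_sub A A' B B' : submodule A' -> A `<=` A' -> A' `<=` B' ->
  B' `<=` B -> fin_length A B -> fin_length A' B'.
Proof.
move=> sA' AA' AB' B'B [n [_ maxn]]; apply: (@max_chain_bounded _ _ n).
  by exists A'; split.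
by move=> k chk; apply: maxn; apply: strict_chain_between chk.
Qed.

Lemma fin_length_refl A : submodule A -> is_length A A 0.
Proof.
move=> sA; split; first by exists (fun=> A); split=> // i _; split.
case=> // k [c [Pc ltc]]; have [_ []] := ltc 0%N isT.
have [_ _ c1A] := Pc 1%N isT; have [_ Ac0 _] := Pc 0%N isT.
exact: subset_trans Ac0.
Qed.

(** Concatenation produces a chain of p + q steps from A to C, and [strict_chain_split] shows that
    no chain is longer. *)
Lemma is_lengthD A B C p q : submodule B -> A `<=` B -> B `<=` C -> submodule C ->
  is_length A B p -> is_length B C q -> is_length A C (p + q)%N.
Proof.
move=> sB AB BC sC [cp maxp] [cq maxq]; split; first exact: strict_chain_cat cp cq.
move=> k chk; have [p' [q' [lek cp' cq']]] := strict_chain_split sB AB chk.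
apply: leq_trans lek _; apply: leq_add.
  by apply: maxp; apply: strict_chain_between cp' => // a [].
apply: maxq; apply: strict_chain_between cq' => //.
by apply: smodD_sub.
Qed.

Lemma fin_length_trans A B C : submodule B -> A `<=` B -> B `<=` C -> submodule C ->
  fin_length A B -> fin_length B C -> fin_length A C.
Proof.
by move=> sB AB BC sC [p lp] [q lq]; exists (p + q)%N; apply: is_lengthD lp lq.
Qed.

Lemma lengthD A B C : submodule A -> submodule B -> submodule C ->
  A `<=` B -> B `<=` C -> fin_length A C ->
  length A C = (length A B + length B C)%N.
Proof.
move=> sA sB sC AB BC fAC; apply: is_length_length; apply: (@is_lengthD A B C) => //;
  by apply: fin_lengthP; apply: fin_length_sub fAC.
Qed.

End Submodules.

(** * Invariance of length under isomorphisms of subquotients *)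

Section Isomorphism.
Variables (R : comNzRingType) (M M' : lmodType R) (f : {linear M -> M'}).
Variables (A B : set M) (A' B' : set M').
Hypotheses (sA : submodule A) (sB : submodule B).
Hypotheses (sA' : submodule A') (sB' : submodule B').
Hypotheses (AB : A `<=` B) (AB' : A' `<=` B').
Hypothesis fB : forall b, B b -> B' (f b).
Hypothesis fA : forall b, B b -> A b <-> A' (f b).
Hypothesis f_surj : forall b', B' b' -> exists2 b, B b & A' (b' - f b).

(** The hypotheses say that [f] induces an isomorphism from B/A to B'/A'. Chains travel forth by N
    |-> f(N) + A' and back by intersecting the preimage of N' with B; both maps preserve strict
    inclusions, so the same chain lengths occur on both sides. *)
Lemma is_length_iso n : is_length A B n <-> is_length A' B' n.
Proof.
suff H k : strict_chain (between A B) k <-> strict_chain (between A' B') k.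
  by split=> -[ch maxn]; split=> [|k /H]; [exact/H|exact: maxn|exact/H|exact: maxn].
split.
- apply: (strict_chain_map (phi := fun N => smodD (f @` N) A')).
    move=> N [sN AN NB].
    have sfN : submodule (f @` N).
      split=> [|_ _ [a Na <-] [b Nb <-]|r _ [a Na <-]].
      * by exists 0; [exact: submodule0|rewrite linear0].
      * by exists (a + b); [exact: submoduleD|rewrite linearD].
      * by exists (r *: a); [exact: submoduleZ|rewrite linearZ].
    split; [exact: submodule_smodD|exact: smodDr|].
    by apply: smodD_sub => // _ [a Na <-]; apply/fB/NB.
  move=> N N' [sN AN NB] [sN' AN' NB'] [NN' nN'N]; split.
    by apply: smodDSS => // _ [a Na <-]; exists a => //; apply: NN'.
  move=> sub; apply: nN'N => a N'a.
  have [|_ [b Nb <-] [a' A'a' eqa]] := sub (f a).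
    by apply: smodDl => //; exists a.
  have Aab : A (a - b).
    apply/fA; first by apply: submoduleB; [|exact: NB'|exact: NB].
    by rewrite linearB -eqa addrAC subrr add0r.
  by rewrite -(subrK b a); apply: submoduleD => //; apply: AN.
- apply: (strict_chain_map (phi := fun N => f @^-1` N `&` B)).
    move=> N [sN AN NB]; split.
    + apply: submoduleI => //; split=> [|a b|r a] /=.
      * by rewrite linear0; apply: submodule0.
      * by rewrite linearD; apply: submoduleD.
      * by rewrite linearZ; apply: submoduleZ.
    + by move=> a Aa; split; [apply/AN/fA => //; apply: AB|apply: AB].
    + by move=> a [].
  move=> N N' [sN AN NB] [sN' AN' NB'] [NN' nN'N]; split.
    by apply: setSI => a /NN'.
  move=> sub; apply: nN'N => a' N'a'.
  have [b Bb A'ab] := f_surj (NB' _ N'a').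
  have [] := sub b; last first.
    by move=> Nfb _; rewrite -(subrK (f b) a'); apply: submoduleD => //; apply: AN.
  split=> //=; rewrite -(subKr a' (f b)); apply: submoduleB => //; exact: AN'.
Qed.

Lemma length_iso : length A B = length A' B'.
Proof.
by rewrite /length; congr xget; apply/seteqP; split=> n /=; apply is_length_iso.
Qed.

End Isomorphism.

(** * Products, radicals and colons of ideals; quotient rings of finite length *)

Section IdealTheory.
Variable R : comNzRingType.
Implicit Types (I J K L m : set R) (a b r y : R).

Lemma ideal_mem0 I : ideal I -> I 0. Proof. exact: submodule0. Qed.

Lemma ideal_memD I a b : ideal I -> I a -> I b -> I (a + b).
Proof. exact: submoduleD. Qed.

Lemma ideal_mull I r a : ideal I -> I a -> I (r * a).
Proof. exact: submoduleZ. Qed.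

Lemma ideal_mulr I r a : ideal I -> I a -> I (a * r).
Proof. by move=> iI Ia; rewrite mulrC; apply: ideal_mull. Qed.

Lemma ideal_memB I a b : ideal I -> I a -> I b -> I (a - b).
Proof. exact: submoduleB. Qed.

Lemma ideal_setT : ideal (setT : set R). Proof. by []. Qed.

Lemma ideal_smodD I J : ideal I -> ideal J -> ideal (smodD (I : set R^o) J).
Proof. exact: submodule_smodD. Qed.

Lemma ideal_gen_ideal (S : set R) : ideal (ideal_gen S).
Proof.
split=> [J [iJ _]|a b Ia Ib J [iJ SJ]|r a Ia J [iJ SJ]]; first exact: ideal_mem0.
  by apply: ideal_memD => //; [apply: Ia|apply: Ib].
by apply: ideal_mull => //; apply: Ia.
Qed.

Lemma sub_ideal_gen (S : set R) : S `<=` ideal_gen S.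
Proof. exact: sub_gen_smallest. Qed.

Lemma ideal_gen_sub (S : set R) I : ideal I -> S `<=` I -> ideal_gen S `<=` I.
Proof. by move=> iI SI; apply: smallest_sub. Qed.

Lemma idealM_ideal I J : ideal (idealM I J). Proof. exact: ideal_gen_ideal. Qed.

Lemma mem_idealM I J a b : I a -> J b -> idealM I J (a * b).
Proof. by move=> Ia Jb; apply: sub_ideal_gen; exists a => //; exists b. Qed.

Lemma idealM_sub I J K : ideal K -> (forall a b, I a -> J b -> K (a * b)) ->
  idealM I J `<=` K.
Proof. by move=> iK IJK; apply: ideal_gen_sub => // _ [a Ia [b Jb <-]]; apply: IJK. Qed.

Lemma idealMSS I I' J J' : I `<=` I' -> J `<=` J' -> idealM I J `<=` idealM I' J'.
Proof.
move=> II' JJ'; apply: idealM_sub; first exact: idealM_ideal.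
by move=> a b Ia Jb; apply: mem_idealM; [apply: II'|apply: JJ'].
Qed.

Lemma idealM_subl I J : ideal I -> idealM I J `<=` I.
Proof. by move=> iI; apply: idealM_sub => // a b Ia _; apply: ideal_mulr. Qed.

Lemma idealM_subr I J : ideal J -> idealM I J `<=` J.
Proof. by move=> iJ; apply: idealM_sub => // a b _; apply: ideal_mull. Qed.

Lemma idealMA I J K : idealM I (idealM J K) = idealM (idealM I J) K.
Proof.
apply/seteqP; split.
  apply: idealM_sub => [|a b Ia]; first exact: idealM_ideal.
  pose L : set R := [set b | idealM (idealM I J) K (a * b)].
  suff : idealM J K `<=` L by apply.
  apply: idealM_sub => [|c k Jc Kk]; last first.
    by rewrite /L /= mulrA; apply: mem_idealM => //; apply: mem_idealM.
  have iM := idealM_ideal (idealM I J) K.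
  split=> [|c c'|r c]; rewrite /L /= ?mulr0 ?mulrDr; first exact: ideal_mem0.
    exact: ideal_memD.
  by rewrite [r *: c]/(r * c) mulrCA; apply: ideal_mull.
apply: idealM_sub => [|a b + Kb]; first exact: idealM_ideal.
pose L : set R := [set a | idealM I (idealM J K) (a * b)].
suff : idealM I J `<=` L by apply.
apply: idealM_sub => [|c k Jc Kk]; last first.
  by rewrite /L /= -mulrA; apply: mem_idealM => //; apply: mem_idealM.
have iM := idealM_ideal I (idealM J K).
split=> [|c c'|r c]; rewrite /L /= ?mul0r ?mulrDl; first exact: ideal_mem0.
  exact: ideal_memD.
by rewrite [r *: c]/(r * c) -mulrA; apply: ideal_mull.
Qed.

Lemma idealX_ideal I n : ideal (idealX I n).
Proof. by case: n => [|n]; [exact: ideal_setT|exact: idealM_ideal]. Qed.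

Lemma idealXSS I J n : I `<=` J -> idealX I n `<=` idealX J n.
Proof. by move=> IJ; elim: n => //= n IHn; apply: idealMSS. Qed.

Lemma idealXS_sub I n : idealX I n.+1 `<=` idealX I n.
Proof. by apply: idealM_subr; apply: idealX_ideal. Qed.

Lemma mem_idealX I a n : I a -> idealX I n (a ^+ n).
Proof. by move=> Ia; elim: n => //= n IHn; rewrite exprS; apply: mem_idealM. Qed.

Lemma idealMC I J : idealM I J = idealM J I.
Proof.
apply/seteqP; split; (apply: idealM_sub => [|a b Ha Hb]; first exact: idealM_ideal);
  by rewrite mulrC; apply: mem_idealM.
Qed.

Lemma idealMCA I J K : idealM I (idealM J K) = idealM J (idealM I K).
Proof. by rewrite !idealMA (idealMC I). Qed.

(** With [iter_idealM_sub] this puts I^(n+c) inside J^n, which yields the lower bound for the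
    Hilbert function of I in terms of that of J. *)
Lemma reduction_idealX I J c n : idealM J (idealX I c) = idealX I c.+1 ->
  idealX I (n + c) = iter n (idealM J) (idealX I c).
Proof.
move=> red; elim: n => // n IHn.
rewrite iterS -IHn; elim: n {IHn} => [|n IHn]; first by rewrite add0n red.
by rewrite addSn [RHS]idealMCA -IHn.
Qed.

Lemma iter_idealM_sub J L n : iter n (idealM J) L `<=` idealX J n.
Proof. by elim: n => // n IHn; apply: idealMSS. Qed.

Lemma radicalD I a b : ideal I -> radical I a -> radical I b -> radical I (a + b).
Proof.
move=> iI [n In] [k Ik]; exists (n + k)%N; rewrite exprDn.
apply: (submodule_sum (N := I : set R^o)) => // i _; rewrite -mulr_natl.
apply: ideal_mull => //; have [leki|ltik] := leqP k i.
  by rewrite -(subnK leki) exprD mulrA; apply: ideal_mull.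
rewrite mulrC; apply: ideal_mull => //.
by rewrite -addnBA ?(ltnW ltik) // addnC exprD; apply: ideal_mull.
Qed.

Lemma radicalMl I r a : ideal I -> radical I a -> radical I (r * a).
Proof. by move=> iI [n In]; exists n; rewrite exprMn; apply: ideal_mull. Qed.

Lemma ideal_radical I : ideal I -> ideal (radical I).
Proof.
move=> iI; split=> [|a b|r a]; [|exact: radicalD|exact: radicalMl].
by exists 1%N; rewrite expr1; apply: ideal_mem0.
Qed.

Lemma radical_sub I J : I `<=` J -> radical I `<=` radical J.
Proof. by move=> IJ a [n /IJ]; exists n. Qed.

Lemma radical_radical I : radical (radical I) `<=` radical I.
Proof. by move=> a [n [k]]; rewrite -exprM; exists (n * k)%N. Qed.

Lemma sub_radical I : I `<=` radical I.
Proof. by move=> a Ia; exists 1%N. Qed.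

Lemma radical_idealM I J a : radical I a -> radical J a -> radical (idealM I J) a.
Proof. by move=> [n In] [k Jk]; exists (n + k)%N; rewrite exprD; apply: mem_idealM. Qed.

Lemma radical_idealX I n : radical I `<=` radical (idealX I n).
Proof.
move=> a Ia; elim: n => [|n IHn]; first by exists 0%N.
exact: radical_idealM.
Qed.

Definition colon I y : set R := [set a | I (y * a)].

Lemma ideal_colon I y : ideal I -> ideal (colon I y).
Proof.
move=> iI; split=> [|a b|r a]; rewrite /colon /=.
- by rewrite mulr0; apply: ideal_mem0.
- by rewrite mulrDr; apply: ideal_memD.
- by rewrite [r *: a]/(r * a) mulrCA; apply: ideal_mull.
Qed.

(** The ideal I + yR, written as a congruence so that membership hands over the cofactor of y. *)
Definition ideal_adj I y : set R := [set a | exists r, I (a - y * r)].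

Lemma ideal_ideal_adj I y : ideal I -> ideal (ideal_adj I y).
Proof.
move=> iI; split=> [|a b [r Ia] [s Ib]|r a [s Ia]].
- by exists 0; rewrite mulr0 subr0; apply: ideal_mem0.
- by exists (r + s); rewrite mulrDr opprD addrACA; apply: ideal_memD.
- by exists (r * s); rewrite [r *: a]/(r * a) mulrCA -mulrBr; apply: ideal_mull.
Qed.

Lemma sub_ideal_adj I y : ideal I -> I `<=` ideal_adj I y.
Proof. by move=> iI a Ia; exists 0; rewrite mulr0 subr0. Qed.

Lemma mem_ideal_adj I y : ideal I -> ideal_adj I y y.
Proof. by move=> iI; exists 1; rewrite mulr1 subrr; apply: ideal_mem0. Qed.

Lemma ideal_adj_sub I y K : ideal K -> I `<=` K -> K y -> ideal_adj I y `<=` K.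
Proof.
move=> iK IK Ky a [r /IK Ka]; rewrite -(subrK (y * r) a).
by apply: ideal_memD => //; apply: ideal_mulr.
Qed.

Definition mulo y : R^o -> R^o := fun a => y * a.

Fact mulo_is_linear y : linear (mulo y).
Proof. by move=> r a b; rewrite /mulo mulrDr [r *: a]/(r * a) mulrCA. Qed.

HB.instance Definition _ y :=
  GRing.isLinear.Build R R^o R^o *:%R (mulo y) (mulo_is_linear y).

(** Multiplication by y induces an isomorphism from R/(I : y) onto (I + yR)/I. *)
Lemma is_length_colon I y n : ideal I ->
  is_length (colon I y : set R^o) setT n <-> is_length (I : set R^o) (ideal_adj I y) n.
Proof.
move=> iI; apply: (is_length_iso (f := mulo y)) => //; rewrite /mulo.
- exact: ideal_ideal_adj.
- exact: sub_ideal_adj.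
- by move=> b _; apply: ideal_mulr; [exact: ideal_ideal_adj|exact: mem_ideal_adj].
- by move=> b [r Ib]; exists r.
Qed.

Lemma ell_colon I y : ideal I -> ell (colon I y) setT = ell I (ideal_adj I y).
Proof.
move=> iI; rewrite /ell /length; congr xget.
by apply/seteqP; split=> n /=; apply is_length_colon.
Qed.

Lemma fin_length_maximal m : maximal_ideal m -> fin_length (m : set R^o) setT.
Proof.
case=> im _ maxm; apply: (@max_chain_bounded _ _ 1%N); first by exists m; split.
case=> [|[|k]] // [c [Pc ltc]].
have [s0 m0 _] := Pc 0%N isT; have [s1 m1 _] := Pc 1%N isT.
have [[_ n10] [_ n21]] := (ltc 0%N isT, ltc 1%N isT).
have [c1m|c1T] := maxm _ s1 m1; first by case: n10; rewrite c1m.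
by case: n21; rewrite c1T.
Qed.

(** R/I is filtered by the ideals I + y^k R, from R at k = 0 down to I at k = n. Multiplication by
    y^k presents the k-th factor as a quotient of R/(I + yR). *)
Lemma fin_length_ideal_adj I y n : ideal I -> I (y ^+ n) ->
  fin_length (ideal_adj I y : set R^o) setT -> fin_length (I : set R^o) setT.
Proof.
move=> iI Iyn finIy.
suff H k : fin_length (ideal_adj I (y ^+ k) : set R^o) setT.
  apply: (fin_length_sub (A := ideal_adj I (y ^+ n) : set R^o) _ _ _ _ (H n)) => //.
  exact: ideal_adj_sub.
elim: k => [|k IHk].
  exists 0%N; rewrite expr0 (_ : ideal_adj I 1 = setT); first exact: fin_length_refl.
  by apply/seteqP; split=> // a _; exists a; rewrite mul1r subrr; apply: ideal_mem0.
have iA k' := ideal_ideal_adj (y ^+ k') iI.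
have AB : ideal_adj I (y ^+ k.+1) `<=` ideal_adj I (y ^+ k).
  apply: ideal_adj_sub => //; first exact: sub_ideal_adj.
  by rewrite exprS; apply: ideal_mull => //; apply: mem_ideal_adj.
apply: (fin_length_trans (B := ideal_adj I (y ^+ k) : set R^o)) => //; first exact: iA.
have [l ll] : fin_length (colon (ideal_adj I (y ^+ k.+1)) (y ^+ k) : set R^o) setT.
  apply: fin_length_sub finIy => //; first exact/ideal_colon/iA.
  apply: ideal_adj_sub; first exact/ideal_colon/iA.
    move=> a Ia; rewrite /colon /=; apply: ideal_mull; first exact: iA.
    exact: sub_ideal_adj.
  by rewrite /colon /= -exprSr; apply: mem_ideal_adj.
have /is_length_colon-/(_ (iA _)) ll' := ll.
have finA : fin_length (ideal_adj I (y ^+ k.+1) : set R^o)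
  (ideal_adj (ideal_adj I (y ^+ k.+1)) (y ^+ k)) by exists l.
apply: fin_length_sub finA => //; first exact: iA.
apply: ideal_adj_sub; first exact/ideal_ideal_adj/iA.
  by move=> a Ia; apply: sub_ideal_adj; [exact: iA|exact: sub_ideal_adj].
exact/mem_ideal_adj/iA.
Qed.

(** The finitely many generators of m are adjoined to I one at a time. Each has a power in I, so
    [fin_length_ideal_adj] brings finiteness down from an ideal that contains m. *)
Lemma fin_length_radical m I : noetherian R -> maximal_ideal m -> ideal I ->
  m `<=` radical I -> fin_length (I : set R^o) setT.
Proof.
move=> noeR maxm; have [im _ _] := maxm; have [s ms] := noeR m im.
have finK K : ideal K -> m `<=` K -> fin_length (K : set R^o) setT.
  by move=> iK mK; apply: fin_length_sub (fin_length_maximal maxm).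
rewrite ms => iI /(subset_trans (@sub_ideal_gen _)).
(* Finiteness at the far end is kept as a statement about all ideals K above I and the remaining
   generators, because I grows while the list shrinks. *)
have : forall K, ideal K -> I `<=` K -> [set` s] `<=` K ->
    fin_length (K : set R^o) setT.
  by move=> K iK _ sK; apply: finK => //; rewrite ms; apply: ideal_gen_sub.
elim: s I iI {ms} => [|g s IHs] I iI fin_s sI; first by apply: fin_s.
have [|n Ign] := sI g; first exact: mem_head.
apply: fin_length_ideal_adj Ign _ => //; apply: IHs; first exact: ideal_ideal_adj.
  move=> K iK IK sK; apply: fin_s => //.
    by apply: subset_trans IK; apply: sub_ideal_adj.
  move=> a /=; rewrite in_cons => /predU1P[->|]; last exact: sK.
  exact/IK/mem_ideal_adj.
move=> a /= sa; apply: radical_sub (sI a _); first exact: sub_ideal_adj.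
by rewrite /= in_cons sa orbT.
Qed.

End IdealTheory.

(** * Ideals spanned by part of a finite family *)

Section Spans.
Variables (R : comNzRingType) (d : nat).
Implicit Types (x c : 'I_d -> R) (U V : {set 'I_d}).

Definition ideal_span x U : set R := [set a | exists c, a = \sum_(u in U) c u * x u].

Lemma ideal_ideal_span x U : ideal (ideal_span x U).
Proof.
split=> [|_ _ [c ->] [c' ->]|r _ [c ->]].
- by exists (fun=> 0); rewrite big1 // => u _; rewrite mul0r.
- by exists (fun u => c u + c' u); rewrite -big_split; apply: eq_bigr => u _;
  rewrite mulrDl.
- exists (fun u => r * c u); rewrite -[LHS]/(r * \sum_(u in U) c u * x u) mulr_sumr.
  by apply: eq_bigr => u _; rewrite mulrA.
Qed.

Lemma mem_ideal_span x U u : u \in U -> ideal_span x U (x u).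
Proof.
move=> Uu; exists (fun v => (v == u)%:R); rewrite (bigD1 u) //= eqxx mul1r.
by rewrite big1 ?addr0 // => v /andP[_ /negPf->]; rewrite mul0r.
Qed.

Lemma ideal_span_sub x U (K : set R) : ideal K -> (forall u, u \in U -> K (x u)) ->
  ideal_span x U `<=` K.
Proof.
move=> iK xK _ [c ->]; apply: (submodule_sum (N := K : set R^o)) => // u Uu.
by apply: (ideal_mull _ iK); apply: xK.
Qed.

Lemma ideal_gen_range x : ideal_gen (range x) = ideal_span x finset.setT.
Proof.
apply/seteqP; split; last first.
  by apply: ideal_span_sub => [|u _]; [exact: ideal_gen_ideal|apply: sub_ideal_gen;
    exists u].
by apply: ideal_gen_sub => [|_ [u _ <-]];
  [exact: ideal_ideal_span|exact: mem_ideal_span].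
Qed.

Lemma idealM_ideal_span (I : set R) x a : ideal I ->
  idealM I (ideal_span x finset.setT) a ->
  exists2 c, (forall u, I (c u)) & a = \sum_u c u * x u.
Proof.
move=> iI; pose K : set R := [set a | exists2 c, (forall u, I (c u)) & a = \sum_u c u
  * x u].
suff : idealM I (ideal_span x finset.setT) `<=` K by apply.
apply: idealM_sub.
  split=> [|_ _ [c Ic ->] [c' Ic' ->]|r _ [c Ic ->]].
  - exists (fun=> 0); first by move=> _; apply: ideal_mem0.
    by rewrite big1 // => u _; rewrite mul0r.
  - exists (fun u => c u + c' u); first by move=> u; apply: ideal_memD.
    by rewrite -big_split; apply: eq_bigr => u _; rewrite mulrDl.
  - exists (fun u => r * c u); first by move=> u; apply: ideal_mull.
    by rewrite -[LHS]/(r * \sum_u c u * x u) mulr_sumr; apply: eq_bigr => u _;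
      rewrite mulrA.
move=> b _ Ib [c ->]; exists (fun u => b * c u); first by move=> u; apply: ideal_mulr.
by rewrite mulr_sumr; apply: eq_big => [u|u _]; rewrite ?inE // mulrA.
Qed.

End Spans.

(** The terms are paired off by the order of the indices; comparing the sum with its negative would
    not suffice where 2 cannot be cancelled. *)
Lemma sum_alternating (V : zmodType) d (F : 'I_d -> 'I_d -> V) :
  (forall j, F j j = 0) -> (forall j k, F j k = - F k j) ->
  \sum_j \sum_k F j k = 0.
Proof.
move=> F0 FN; pose G (j k : 'I_d) := if (k < j)%N then F j k else 0.
have FG j k : F j k = G j k - G k j.
  rewrite /G; case: ltngtP => [_|_|/val_inj->]; rewrite ?subr0 ?sub0r //.
under eq_bigr => j _ do (under eq_bigr => k _ do rewrite FG; rewrite sumrB).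
by rewrite sumrB [X in _ - X]exchange_big subrr.
Qed.

(** * The Koszul complex: null-homotopies, acyclicity, syzygies *)

Section KoszulTheory.
Variables (R : comNzRingType) (d : nat).
Implicit Types (T : {set 'I_d}) (j k : 'I_d) (a b : {set 'I_d} -> R).

Let sg j T : R := (-1) ^+ #|[pred k in T | (k < j)%N]|.

Let sgU j k T : k \notin T -> sg j (k |: T) = if (k < j)%N then - sg j T else sg j T.
Proof.
move=> kT; rewrite /sg; case: ifP => ltkj.
  rewrite (cardD1 k) !inE eqxx ltkj exprS mulN1r; congr (- (_ ^+ _)).
  apply: eq_card => l; rewrite !inE; case: eqP => [->|//].
  by rewrite (negPf kT).
congr (_ ^+ _); apply: eq_card => l; rewrite !inE.
by case: eqP => [->|//]; rewrite (negPf kT) ltkj.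
Qed.

Let sgUj j T : sg j (j |: T) = sg j T.
Proof.
by congr (_ ^+ _); apply: eq_card => l; rewrite !inE; case: eqP => // ->;
  rewrite ltnn !andbF.
Qed.

Let sgDj j T : sg j (T :\ j) = sg j T.
Proof.
by congr (_ ^+ _); apply: eq_card => l; rewrite !inE; case: eqP => // ->;
  rewrite ltnn !andbF.
Qed.

Let sg2 j T : sg j T * sg j T = 1.
Proof. by rewrite -expr2 sqrr_sign. Qed.

(* Contraction with the dual of e_j and multiplication by e_j: the Koszul
   differential is \sum_j x_j contr j. *)
Let contr j a T : R := if j \in T then 0 else sg j T * a (j |: T).

Let wedge j a T : R := if j \in T then sg j T * a (T :\ j) else 0.

Let contr_contr j k a T : contr j (contr k a) T = - contr k (contr j a) T.
Proof.
rewrite /contr !inE; have [-> | neq_jk] := eqVneq j k.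
  by rewrite mulr0; case: ifP; rewrite oppr0.
rewrite /=; case: ifPn => jT; case: ifPn => kT;
  rewrite ?mulr0 ?oppr0 //.
rewrite !sgU // finset.setUCA.
by case: (ltngtP j k) => [||/val_inj eq_jk]; rewrite ?mulNr ?mulrN ?opprK 1?mulrCA //;
  rewrite eq_jk eqxx in neq_jk.
Qed.

Let contr2 j a T : contr j (contr j a) T = 0.
Proof. by rewrite /contr !inE eqxx mulr0; case: ifP. Qed.

(** The anticommutation relation between contraction with the dual of e_j and multiplication by e_k;
    the null-homotopy below rests on it. *)
Let wedge_contr j k a T :
  contr j (wedge k a) T + wedge k (contr j a) T = if j == k then a T else 0.
Proof.
rewrite /contr /wedge !inE; have [<-{k} | neq_jk] := eqVneq j k.
  case: ifPn => jT; rewrite ?eqxx /= ?add0r ?addr0.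
    by rewrite finset.setD1K // mulrA sgDj sg2 mul1r.
  by rewrite finset.setU1K // mulrA sgUj sg2 mul1r.
rewrite /=; case: ifPn => jT.
  by rewrite add0r; case: ifP => //; rewrite mulr0.
case: ifPn => kT; rewrite ?mulr0 ?addr0 //.
have -> : (j |: T) :\ k = j |: T :\ k.
  by apply/setP => l; rewrite !inE; case: eqP => // ->; rewrite eq_sym (negPf neq_jk).
rewrite sgU // -{1}(finset.setD1K kT) sgU ?inE ?eqxx //.
by case: (ltngtP j k) => [||/val_inj eq_jk];
  rewrite ?mulNr ?mulrN ?mulrA 1?(mulrC (sg k T)) ?addNr ?subrr //;
  rewrite eq_jk eqxx in neq_jk.
Qed.

Variable x : 'I_d -> R.
Implicit Types z w : koszul R d.

Let diffE z T : koszul_diff x z T = \sum_j x j * contr j (fun S => z S) T.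
Proof.
rewrite ffunE big_mkcond; apply: eq_bigr => j _; rewrite /contr.
by case: (j \in T); rewrite /= ?mulr0 // mulrA (mulrC (x j)).
Qed.

Let contr_sum j (c : 'I_d -> R) (f : 'I_d -> {set 'I_d} -> R) T :
  contr j (fun S => \sum_k c k * f k S) T = \sum_k c k * contr j (f k) T.
Proof.
rewrite /contr; case: ifP => _; first by rewrite big1 // => k _; rewrite mulr0.
by rewrite mulr_sumr; apply: eq_bigr => k _; rewrite mulrCA.
Qed.

Let wedge_sum j (c : 'I_d -> R) (f : 'I_d -> {set 'I_d} -> R) T :
  wedge j (fun S => \sum_k c k * f k S) T = \sum_k c k * wedge j (f k) T.
Proof.
rewrite /wedge; case: ifP => _; last by rewrite big1 // => k _; rewrite mulr0.
by rewrite mulr_sumr; apply: eq_bigr => k _; rewrite mulrCA.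
Qed.

Let diff_fun z : (fun S => koszul_diff x z S) =
  (fun S => \sum_j x j * contr j (fun S => z S) S) :> ({set 'I_d} -> R).
Proof. by apply/funext => S; rewrite diffE. Qed.

Fact koszul_diff_is_linear : linear (koszul_diff x : koszul R d -> koszul R d).
Proof.
move=> r z w; apply/ffunP => T; rewrite !ffunE [X in _ = X + _]mulr_sumr -big_split.
by apply: eq_bigr => j _; rewrite !ffunE mulrDr mulrCA.
Qed.

HB.instance Definition _ := GRing.isLinear.Build R (koszul R d) (koszul R d) *:%R
  (koszul_diff x) koszul_diff_is_linear.

Lemma koszul_diff_diff z : koszul_diff x (koszul_diff x z) = 0.
Proof.
apply/ffunP => T; rewrite diffE [RHS]ffunE.
under eq_bigr => j _ do rewrite diff_fun contr_sum mulr_sumr.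
apply: sum_alternating => [j|j k]; first by rewrite contr2 !mulr0.
by rewrite contr_contr !mulrN mulrCA.
Qed.

Lemma koszul_degD i z w : koszul_deg i z -> koszul_deg i w -> koszul_deg i (z + w).
Proof. by move=> zi wi S Si; rewrite ffunE zi // wi // addr0. Qed.

Lemma koszul_degZ i r z : koszul_deg i z -> koszul_deg i (r *: z).
Proof. by move=> zi S Si; rewrite ffunE zi // scaler0. Qed.

Lemma submodule_koszul_deg i : submodule (@koszul_deg R d i).
Proof.
by split=> [S _|z w|r z]; [rewrite ffunE|exact: koszul_degD|exact: koszul_degZ].
Qed.

Lemma koszul_diff_deg i z : koszul_deg i.+1 z -> koszul_deg i (koszul_diff x z).
Proof.
move=> zi T Ti; rewrite ffunE big1 // => j jT.
by rewrite zi ?mulr0 // cardsU1 jT add1n eqSS.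
Qed.

Lemma koszul_deg_gt i z : (d < i)%N -> koszul_deg i z -> z = 0.
Proof.
move=> ltdi zi; apply/ffunP => S; rewrite zi ?ffunE //.
by rewrite neq_ltn (leq_ltn_trans (max_card _)) ?card_ord.
Qed.

Lemma koszul_diff_mod (Q : set R) z : ideal Q -> (forall S, Q (z S)) ->
  forall S, Q (koszul_diff x z S).
Proof.
move=> iQ Qz S; rewrite ffunE; apply: (submodule_sum (N := Q : set R^o)) => // j _.
exact: (ideal_mull _ iQ).
Qed.

(* Multiplication by y in (x) is null-homotopic on the Koszul complex of x. *)
Lemma koszul_homotopy (Q : set R) i y z : ideal Q -> ideal_span x finset.setT y ->
  koszul_deg i z -> (forall S, Q (koszul_diff x z S)) ->
  exists2 w, koszul_deg i.+1 w & forall S, Q ((y *: z - koszul_diff x w) S).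
Proof.
move=> iQ [c ->] zi Qz.
(* The homotopy is exterior multiplication by the sum of the c_k e_k. By [wedge_contr] its
   anticommutator with the differential is multiplication by y, so y z minus the differential of h z
   is h applied to the differential of z, whose entries lie in Q. *)
pose h (u : koszul R d) : koszul R d := [ffun T => \sum_k c k * wedge k (fun S => u S)
  T].
exists (h z).
  move=> T Ti; rewrite ffunE big1 // => k _; rewrite /wedge; case: ifP => kT;
    last by rewrite mulr0.
  rewrite zi ?mulr0 //; apply: contraNneq Ti => <-.
  by rewrite (cardsD1 k) kT.
move=> S; suff -> : ((\sum_(u in finset.setT) c u * x u) *: z - koszul_diff x (h z)) S
    = h (koszul_diff x z) S.
  rewrite ffunE; apply: (submodule_sum (N := Q : set R^o)) => // k _.
  apply: (ideal_mull _ iQ); rewrite /wedge; case: ifP => _; last exact: ideal_mem0.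
  exact: (ideal_mull _ iQ).
have h_fun u : (fun S => h u S) =
    (fun T => \sum_k c k * wedge k (fun S => u S) T) :> ({set 'I_d} -> R).
  by apply/funext => T; rewrite ffunE.
rewrite [RHS]ffunE diff_fun; under [RHS]eq_bigr => k _ do rewrite wedge_sum mulr_sumr.
rewrite exchange_big /= [LHS]ffunE [X in _ + X]ffunE diffE h_fun.
under [X in _ - X]eq_bigr => j _ do rewrite contr_sum mulr_sumr.
apply/eqP; rewrite subr_eq -big_split /= ffunE [_ *: _]mulr_suml; apply/eqP.
apply: eq_big => [j|j _]; first by rewrite inE.
rewrite -big_split /= (bigD1 j) //= big1 => [|k neq_kj]; last first.
  rewrite [x _ * (c _ * _)]mulrCA -2!mulrDr addrC wedge_contr eq_sym (negPf neq_kj)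
    !mulr0 //.
by rewrite [x _ * (c _ * _)]mulrCA -2!mulrDr addr0 addrC wedge_contr eqxx mulrA.
Qed.

Let subE z w S : (z - w) S = z S - w S. Proof. by rewrite !ffunE. Qed.

Let scaleE (r : R) z S : (r *: z) S = r * z S. Proof. by rewrite ffunE. Qed.

(** Vanishing of H_i(x; R/Q), expressed by representatives over R so that Q can vary along a regular
    sequence. *)
Definition koszul_exact_mod (Q : set R) i : Prop :=
  forall z, koszul_deg i z -> (forall S, Q (koszul_diff x z S)) ->
  exists2 w, koszul_deg i.+1 w & forall S, Q ((z - koszul_diff x w) S).

Lemma koszul_exact_mod_gt (Q : set R) i : ideal Q -> (d < i)%N -> koszul_exact_mod Q i.
Proof.
move=> iQ ltdi z zi _; exists 0; first exact: (submodule0 (submodule_koszul_deg _)).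
by move=> S; rewrite (koszul_deg_gt ltdi zi) linear0 subr0 ffunE; apply: ideal_mem0.
Qed.

(** As y is regular on R/Q, vanishing of H_(i+1)(x; R/(Q + yR)) makes y injective on H_i(x; R/Q), by
    the long exact sequence. A power of y lies in (x) and kills that homology, which is therefore
    zero. The proof cancels the factors y one by one. *)
Lemma koszul_exact_mod_step (Q : set R) i (y : R) : ideal Q ->
  (forall a : R, Q (y * a) -> Q a) -> radical (ideal_span x finset.setT) y ->
  koszul_exact_mod (ideal_adj Q y) i.+1 -> koszul_exact_mod Q i.
Proof.
move=> iQ regy [n ynx] exy z zi Qz.
have [w wi] := koszul_homotopy iQ ynx zi Qz.
elim: n w wi {ynx} => [|n IHn] w wi Qw.
  by exists w => // S; have := Qw S; rewrite expr0 scale1r.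
have iA := ideal_ideal_adj y iQ.
have Qdw S : ideal_adj Q y (koszul_diff x w S).
  exists (y ^+ n * z S); rewrite mulrA -exprS -opprB;
    apply: (submoduleN (N := Q : set R^o)) => //.
  by have := Qw S; rewrite subE scaleE.
have [u ui Au] := exy w wi Qdw.
have /choice[r Qr] : forall S : {set _}, exists r : R, Q ((w - koszul_diff x u) S - y
  * r) by [].
(* The cofactors [r] were chosen entry by entry and are arbitrary off the subsets of size i + 1, so
   they are truncated to a chain of degree i + 1. *)
pose v : koszul R d := [ffun S : {set _} => if #|S| == i.+1 then r S else 0].
have vi : koszul_deg i.+1 v by move=> S Si; rewrite ffunE (negPf Si).
have Qv (S : {set _}) : Q ((w - koszul_diff x u - y *: v) S).
  rewrite subE scaleE [v S]ffunE; case: eqP => [_|/eqP Si]; first exact: Qr.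
  by rewrite subE wi // (koszul_diff_deg ui) // mulr0 !subr0; apply: ideal_mem0.
apply: (IHn v vi) => S; apply: regy.
have := koszul_diff_mod iQ Qv S => /(ideal_memD iQ (Qw S)).
rewrite !linearB linearZ /= koszul_diff_diff subr0 !subE !scaleE addrA subrK.
by rewrite exprS -mulrA -mulrBr.
Qed.

(** With Q_k generated by the first k elements of [ys], exactness modulo Q_k holds in degrees above
    k: for k = d there are no chains there, and each step down in k gains one degree. The case k = 0
    is the claim. *)
Lemma koszul_exact (ys : seq R) i : size ys = d -> regular_seq ys ->
  (forall y, y \in ys -> radical (ideal_span x finset.setT) y) -> (0 < i)%N ->
  koszul_exact_mod [set 0] i.
Proof.
move=> sz_ys [_ reg_ys] rad_ys i_gt0.
have i0 : ideal ([set 0] : set R).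
  by split=> // [a b -> ->|r a ->]; rewrite ?addr0 ?scaler0.
pose Q (k : nat) := ideal_gen [set` take k ys].
have Q0 : Q 0%N = [set 0].
  rewrite /Q take0; apply/seteqP; split; first by apply: ideal_gen_sub => // a.
  by move=> _ ->; apply: ideal_mem0; apply: ideal_gen_ideal.
have QS (k : nat) : (k < d)%N -> Q k.+1 = ideal_adj (Q k) ys`_k.
  move=> ltkd; rewrite /Q (take_nth 0) ?sz_ys //.
  have iQ := ideal_gen_ideal [set` take k ys]; have iA := ideal_ideal_adj ys`_k iQ.
  apply/seteqP; split.
    apply: ideal_gen_sub => // a /=; rewrite mem_rcons in_cons => /predU1P[->|ak].
      exact: mem_ideal_adj.
    by apply: sub_ideal_adj => //; apply: sub_ideal_gen.
  apply: ideal_adj_sub; first exact: ideal_gen_ideal.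
    apply: ideal_gen_sub => [|a /= ak]; first exact: ideal_gen_ideal.
    by apply: sub_ideal_gen; rewrite /= mem_rcons in_cons ak orbT.
  by apply: sub_ideal_gen; rewrite /= mem_rcons mem_head.
suff H n : (n <= d)%N -> forall i, (d - n < i)%N -> koszul_exact_mod (Q (d - n)%N) i.
  by rewrite -Q0 -(subnn d); apply: H; rewrite ?subnn.
elim: n => [|n IHn] ltnd k ltk.
  by apply: koszul_exact_mod_gt; [exact: ideal_gen_ideal|rewrite subn0 in ltk].
have lt_dn : (d - n.+1 < d)%N by rewrite ltn_subrL (leq_ltn_trans _ ltnd).
have def_dn : (d - n.+1).+1 = (d - n)%N by rewrite subnSK.
have ys_dn : (d - n.+1 < size ys)%N by rewrite sz_ys.
apply: (koszul_exact_mod_step (y := ys`_(d - n.+1))).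
- exact: ideal_gen_ideal.
- exact: reg_ys.
- exact/rad_ys/mem_nth.
- by move: (IHn (ltnW ltnd)); rewrite -def_dn (QS _ lt_dn); apply; rewrite ltnS.
Qed.

Lemma koszul_diff1 z S : koszul_deg 1 z ->
  koszul_diff x z S = if #|S| == 0%N then \sum_j z [set j]%SET * x j else 0.
Proof.
move=> z1; case: ifPn => S0; last by rewrite (koszul_diff_deg z1).
have {S S0}-> : S = finset.set0 by apply/eqP; rewrite -cards_eq0.
rewrite ffunE; apply: eq_big => [j|j _]; first by rewrite inE.
rewrite finset.setU0 mulrC (_ : #|_| = 0%N) ?mul1r //.
by apply: eq_card0 => k; rewrite !inE.
Qed.

Definition koszul1 (c : 'I_d -> R) : koszul R d :=
  [ffun S => if [pick j | S == [set j]%SET] is Some j then c j else 0].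

Lemma koszul1_deg c : koszul_deg 1 (koszul1 c).
Proof.
move=> S S1; rewrite ffunE; case: pickP => // j /eqP Sj.
by rewrite Sj cards1 in S1.
Qed.

Lemma koszul1E c j : koszul1 c [set j]%SET = c j.
Proof.
rewrite ffunE; case: pickP => [k /eqP/finset.set1_inj->//|/(_ j)].
by rewrite eqxx.
Qed.

Lemma koszul_syzygy (c : 'I_d -> R) : koszul_exact_mod [set 0] 1 ->
  \sum_j c j * x j = 0 ->
  exists2 w, koszul_deg 2 w & koszul1 c = koszul_diff x w.
Proof.
move=> ex1 cx0; have [|w w2 cw] := ex1 _ (koszul1_deg c).
  move=> S; rewrite koszul_diff1; last exact: koszul1_deg.
  by under eq_bigr => j _ do rewrite koszul1E; rewrite cx0; case: ifP.
by exists w => //; apply/ffunP => S; apply/eqP; rewrite -subr_eq0 -subE; apply/eqP/cw.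
Qed.

(** A relation expressing x_j a through the other x_u is a syzygy with coefficient a at j. It is a
    boundary by exactness, and the coefficient at j of a boundary from degree 2 involves only the
    x_k with k different from j. *)
Lemma koszul_exact_regular j (a : R) : koszul_exact_mod [set 0] 1 ->
  ideal_span x (~: [set j]%SET) (x j * a) -> ideal_span x (~: [set j]%SET) a.
Proof.
move=> ex1 [c xjE]; pose c' u := if u == j then a else - c u.
have [|w w2 /ffunP/(_ [set j]%SET)] := @koszul_syzygy c' ex1.
  rewrite (bigD1 j) //= {1}/c' eqxx mulrC xjE.
  rewrite [X in _ + X](eq_bigr (fun u => - (c u * x u))) => [|u /negPf uj]; last first.
    by rewrite /c' uj mulNr.
  rewrite sumrN; apply/eqP; rewrite subr_eq0; apply/eqP.
  by apply: eq_bigl => u; rewrite !inE.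
rewrite koszul1E /c' eqxx ffunE => ->.
apply: (submodule_sum (N := ideal_span x _ : set R^o)); first exact: ideal_ideal_span.
move=> k kj; rewrite mulrAC; apply: ideal_mull; first exact: ideal_ideal_span.
by apply: mem_ideal_span; rewrite inE.
Qed.

End KoszulTheory.

(** * Powers of sums of ideals *)

Section IdealPowers.
Variable R : comNzRingType.
Implicit Types I J K L T Q : set R.

Definition ideal_add (I J : set R) : set R := smodD (I : set R^o) J.

Lemma ideal_ideal_add I J : ideal I -> ideal J -> ideal (ideal_add I J).
Proof. exact: ideal_smodD. Qed.

Lemma ideal_addl I J : ideal J -> I `<=` ideal_add I J.
Proof. exact: smodDl. Qed.

Lemma ideal_addr I J : ideal I -> J `<=` ideal_add I J.
Proof. exact: smodDr. Qed.

Lemma mem_ideal_add I J (a b : R) : I a -> J b -> ideal_add I J (a + b).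
Proof. by move=> Ia Jb; exists a => //; exists b. Qed.

Lemma ideal_addSS I I' J J' : I `<=` I' -> J `<=` J' ->
  ideal_add I J `<=` ideal_add I' J'.
Proof. by move=> II' JJ' _ [a /II' Ia [b /JJ' Jb <-]]; exists a => //; exists b. Qed.

Lemma ideal_addP I J (a : R) : ideal_add I J a ->
  exists q t : R, [/\ I q, J t & a = q + t].
Proof. by case=> q Iq [t Jt <-]; exists q, t. Qed.

Lemma ideal_add_sub I J K : ideal K -> I `<=` K -> J `<=` K -> ideal_add I J `<=` K.
Proof. exact: smodD_sub. Qed.

(** When elements of T are written as an element of L plus a multiple of y, a product has one term
    free of y, lying in the power of L; all others carry y with a cofactor in the next lower power
    of T. This splits one variable off a power. *)
Lemma idealX_ideal_adj L T (y : R) n s : ideal T -> L `<=` T -> T `<=` ideal_adj L y ->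
  idealX T n.+1 s -> exists2 s0, idealX T n s0 & idealX L n.+1 (s - y * s0).
Proof.
move=> iT LT TL; elim: n s => [|n IHn] s.
  move=> /(idealM_subl iT)/TL[r Lr]; exists r => //.
  by rewrite -[_ - _]mulr1; apply: mem_idealM.
pose K : set R := [set s | exists2 s0, idealX T n.+1 s0 & idealX L n.+2 (s - y * s0)].
suff : idealX T n.+2 `<=` K by apply.
have iTX := idealX_ideal T n.+1; have iLX := idealX_ideal L n.+2.
apply: idealM_sub.
  split=> [|a b [a0 Ta La] [b0 Tb Lb]|r a [a0 Ta La]].
  - by exists 0; [exact: (ideal_mem0 iTX)|rewrite mulr0 subr0; exact: (ideal_mem0 iLX)].
  - by exists (a0 + b0); [exact: (ideal_memD iTX)|rewrite mulrDr opprD addrACA;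
    exact: (ideal_memD iLX)].
  - exists (r * a0); first exact: (ideal_mull _ iTX).
    by rewrite [r *: a]/(r * a) mulrCA -mulrBr; apply: (ideal_mull _ iLX).
move=> a b Ta Tb; have [r Lr] := TL _ Ta; have [b0 Tb0 Lb0] := IHn _ Tb.
exists ((a - y * r) * b0 + r * b).
  by apply: (ideal_memD iTX); [apply: mem_idealM => //;
    exact: LT|apply: (ideal_mull _ iTX)].
rewrite (_ : _ - _ = (a - y * r) * (b - y * b0)); first exact: mem_idealM.
by ring.
Qed.

Lemma idealX_ideal_add L Q T n : ideal Q -> ideal T -> L `<=` ideal_add Q T ->
  idealX L n `<=` ideal_add Q (idealX T n).
Proof.
move=> iQ iT LQT; elim: n => [|n IHn]; first by move=> a _; apply: ideal_addr.
have iTX := idealX_ideal T n.+1.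
apply: idealM_sub; first exact: ideal_ideal_add.
move=> _ _ /LQT/ideal_addP[q [t [Qq Tt ->]]] /IHn/ideal_addP[q' [t' [Qq' Tt' ->]]].
rewrite mulrDl mulrDr (mulrDr t) addrA; apply: mem_ideal_add; last exact: mem_idealM.
by apply: (ideal_memD iQ); [apply: (ideal_memD iQ);
  apply: (ideal_mulr _ iQ)|apply: (ideal_mull _ iQ)].
Qed.

End IdealPowers.

Section SpanTheory.
Variables (R : comNzRingType) (d : nat).
Implicit Types (x : 'I_d -> R) (U V : {set 'I_d}) (j k t : 'I_d).

Lemma ideal_spanS x U V : U \subset V -> ideal_span x U `<=` ideal_span x V.
Proof.
move=> UV; apply: ideal_span_sub => [|u Uu]; first exact: ideal_ideal_span.
by apply: mem_ideal_span; apply: (fintype.subsetP UV).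
Qed.

Lemma eq_ideal_span x x' U : {in U, x =1 x'} -> ideal_span x U = ideal_span x' U.
Proof.
move=> xx'; apply/seteqP.
by split=> _ [c ->]; exists c; apply: eq_bigr => u Uu; rewrite xx'.
Qed.

Lemma ideal_span0 x a : ideal_span x finset.set0 a -> a = 0.
Proof. by case=> c ->; rewrite big_set0. Qed.

Lemma ideal_spanU1 x k U : ideal_span x (k |: U) `<=` ideal_adj (ideal_span x U) (x k).
Proof.
have iU := ideal_ideal_span x U; have iA := ideal_ideal_adj (x k) iU.
apply: ideal_span_sub => // u /finset.setU1P[->|Uu]; first exact: mem_ideal_adj.
by apply: sub_ideal_adj => //; apply: mem_ideal_span.
Qed.

Lemma ideal_spanU x U V :
  ideal_span x (U :|: V) `<=` ideal_add (ideal_span x U) (ideal_span x V).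
Proof.
have iU := ideal_ideal_span x U; have iV := ideal_ideal_span x V.
apply: ideal_span_sub => [|u /finset.setUP[Uu|Vu]]; first exact: ideal_ideal_add.
  by apply: ideal_addl => //; apply: mem_ideal_span.
by apply: ideal_addr => //; apply: mem_ideal_span.
Qed.

End SpanTheory.

(** * Quasi-regularity of x and the Hilbert function of J *)

Section QuasiRegular.
Variables (R : comNzRingType) (d : nat) (x : 'I_d -> R).
Implicit Types (e : 'I_d -> nat) (U V : {set 'I_d}) (j k t : 'I_d).

Let xe e : 'I_d -> R := fun u => x u ^+ e u.

(** Demanded for all exponents at once, because the induction below resets the exponents of x_t and
    x_j as it moves these variables out of V. *)
Hypothesis powers_regular : forall e j a,
  ideal_span (xe e) (~: [set j]%SET) (x j * a) -> ideal_span (xe e) (~: [set j]%SET) a.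

Let G e j V n : set R :=
  ideal_add (ideal_span (xe e) (~: (j |: V))) (idealX (ideal_span x V) n).

Let iG e j V n : ideal (G e j V n).
Proof. by apply: ideal_ideal_add; [exact: ideal_ideal_span|exact: idealX_ideal]. Qed.

Let upd e t n : 'I_d -> nat := fun u => if u == t then n else e u.

Let xe_upd e t n U : t \notin U -> ideal_span (xe (upd e t n)) U = ideal_span (xe e) U.
Proof.
move=> tU; apply: eq_ideal_span => u Uu; rewrite /xe /upd.
by case: eqP Uu tU => // -> ->.
Qed.

(* Modulo arbitrarily high powers of x_j this says that x_j is regular modulo
   (x_u^e_u, u outside j and V) + (x_V)^n; allowing these powers avoids any
   appeal to Krull's intersection theorem or to Nakayama's lemma. *)
Lemma colon_powers V e j n a M : j \notin V -> G e j V n (x j * a) ->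
  ideal_adj (G e j V n) (x j ^+ M) a.
Proof.
move: {2}#|V| (erefl #|V|) => l; elim: l V e j n a M => [|l IHl] V e j n a M Vl jV.
  have {Vl jV}-> : V = finset.set0 by apply: cards0_eq.
  case: n => [|n] Gxa.
    by apply: sub_ideal_adj => //; apply: ideal_addr => //; apply: ideal_ideal_span.
  apply: sub_ideal_adj => //; apply: ideal_addl; first exact: idealX_ideal.
  rewrite finset.setU0; apply: powers_regular; case/ideal_addP: Gxa => q [s [Qq]].
  move=> /(idealM_subl (ideal_ideal_span _ _))/ideal_span0 -> ->.
  by rewrite addr0 -(finset.setU0 [set j]%SET).
have /card_gt0P[t tV] : (0 < #|V|)%N by rewrite Vl.
pose V' := V :\ t.
have tV' : t \notin V' by rewrite !inE eqxx.
have V'l : #|V'| = l by apply/eqP; rewrite -eqSS -Vl (cardsD1 t V) tV.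
have neq_jt : j != t by apply: contraNneq jV => ->.
have jV' : j \notin V' by rewrite inE (negPf jV) andbF.
have V'V : V' \subset V by apply: subsetDl.
pose Q := ideal_span (xe e) (~: (j |: V)); have iQ : ideal Q by apply: ideal_ideal_span.
have Ct : ~: (j |: V') = t |: ~: (j |: V).
  apply/setP => u; rewrite !inE; case: (eqVneq u t) => [->|] //=.
  by rewrite eq_sym (negPf neq_jt).
have Cj : ~: (t |: V') = j |: ~: (j |: V).
  apply/setP => u; rewrite !inE; case: (eqVneq u t) => [->|] //=.
    by rewrite tV orbT eq_sym (negPf neq_jt).
  by case: (eqVneq u j) => [->|].
pose T := ideal_span x V; pose T' := ideal_span x V'.
have iT m : ideal (idealX T m) by apply: idealX_ideal.
have iT' m : ideal (idealX T' m) by apply: idealX_ideal.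
have T'T : T' `<=` T by apply: ideal_spanS.
have Txt : T (x t) by apply: mem_ideal_span.
have TT' : T `<=` ideal_adj T' (x t) by move=> u;
  rewrite /T -(finset.setD1K tV) => /ideal_spanU1.
elim: n a => [|n IHn] a Gxa.
  by apply: sub_ideal_adj => //; apply: smodDr.
case/ideal_addP: (Gxa) => q [s [Qq Ts eq_xa]].
have [s0 Ts0 T's] := idealX_ideal_adj (ideal_ideal_span x V) T'T TT' Ts.
have Ts' u : idealX T' n.+1 u -> idealX T n.+1 u by apply: idealXSS.
(* Modulo x_t the power of T reduces to the same power of T', so the induction on V applies with t
   moved outside V at exponent 1. *)
have [r1 /ideal_addP[q1' [s1 [Qq1 T's1 eq_r1]]]] :
    ideal_adj (G (upd e t 1) j V' n.+1) (x j ^+ M) a.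
  apply: IHl => //.
  have -> : x j * a = (q + x t * s0) + (s - x t * s0) by rewrite eq_xa; ring.
  apply: mem_ideal_add => //; rewrite Ct; apply: ideal_memD;
    first exact: ideal_ideal_span.
      apply: ideal_spanS (finset.subsetUr [set t]%SET _) _ _.
      by rewrite xe_upd // !inE negbK tV orbT.
    apply: ideal_mulr; first exact: ideal_ideal_span.
    have := mem_ideal_span (xe (upd e t 1)) (finset.setU11 t (~: (j |: V))).
    by rewrite /xe /upd eqxx expr1.
move: Qq1; rewrite Ct => /ideal_spanU1[b].
rewrite xe_upd; last by rewrite !inE negbK tV orbT.
rewrite -/Q {1}/xe /upd eqxx expr1; set q1 := _ - _ => Qq1.
have eq_a : a = q1 + x t * b + s1 + x j ^+ M * r1.
  by rewrite /q1 subrK -eq_r1 subrK.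
(* Now j and t exchange roles. Substituting a into the relation for x_j a leaves x_t (x_j b - s0) up
   to x_j^(M+1), so j is placed outside V' at exponent M + 1. The error x_t^n is harmless, as it
   lies in T^n. *)
have [r2 /ideal_addP[q2' [s2 [Qq2 T's2 eq_r2]]]] :
    ideal_adj (G (upd e j M.+1) t V' n.+1) (x t ^+ n) (x j * b - s0).
  apply: IHl => //.
  have -> : x t * (x j * b - s0) =
      (q - x j * q1 - x j ^+ M.+1 * r1) + (s - x t * s0 - x j * s1).
    have -> : q = x j * (q1 + x t * b + s1 + x j ^+ M * r1) - s.
      by rewrite -eq_a eq_xa addrK.
    by rewrite exprS; ring.
  apply: mem_ideal_add; last by apply: (ideal_memB (iT' _)) => //;
    apply: (ideal_mull _ (iT' _)).
    rewrite Cj; have iS := ideal_ideal_span (xe (upd e j M.+1)) (j |: ~: (j |: V)).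
    apply: ideal_memB => //.
      apply: ideal_spanS (finset.subsetUr [set j]%SET _) _ _.
      rewrite xe_upd ?inE ?eqxx //; apply: ideal_memB => //; exact: ideal_mull.
    apply: ideal_mulr => //.
    have := mem_ideal_span (xe (upd e j M.+1)) (finset.setU11 j (~: (j |: V))).
    by rewrite /xe /upd eqxx.
move: Qq2; rewrite Cj => /ideal_spanU1[c].
rewrite xe_upd; last by rewrite !inE negbK eqxx.
rewrite -/Q {1}/xe /upd eqxx; set q2 := _ - _ => Qq2.
have eq_b : x j * (b - x j ^+ M * c) = q2 + (s2 + s0 + x t ^+ n * r2).
  have -> : s0 = x j * b - (q2 + x j ^+ M.+1 * c + s2 + x t ^+ n * r2).
    by rewrite /q2 subrK -eq_r2; ring.
  by rewrite exprS; ring.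
(* Only T^n is left on the right, where the induction on n applies; b enters a with the factor x_t,
   which restores T^(n+1). *)
have [r3 /ideal_addP[q3 [s3 [Qq3 Ts3 eq_r3]]]] :
    ideal_adj (G e j V n) (x j ^+ M) (b - x j ^+ M * c).
  apply: IHn; rewrite eq_b; apply: mem_ideal_add => //.
  apply: (ideal_memD (iT n)); last by apply: (ideal_mulr _ (iT n)); apply: mem_idealX.
  by apply: (ideal_memD (iT n)) => //; apply: idealXS_sub; apply: Ts'.
have eq_b3 : b = q3 + s3 + x j ^+ M * (c + r3) by rewrite -eq_r3; ring.
exists (r1 + x t * (c + r3)).
have -> : a - x j ^+ M * (r1 + x t * (c + r3)) = (q1 + x t * q3) + (x t * s3 + s1).
  by rewrite eq_a eq_b3; ring.
apply: mem_ideal_add; first by apply: (ideal_memD iQ) => //; apply: (ideal_mull _ iQ).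
by apply: (ideal_memD (iT n.+1)); [apply: mem_idealM|apply: Ts'].
Qed.

Let J := ideal_span x finset.setT.
Let iJ : ideal J := ideal_ideal_span x finset.setT.
Let H U n : set R := ideal_add (ideal_span x U) (idealX J n).
Let iQ U : ideal (ideal_span x U) := ideal_ideal_span x U.
Let iJX n : ideal (idealX J n) := idealX_ideal J n.
Let iH U n : ideal (H U n) := ideal_ideal_add (iQ U) (iJX n).

Let xJ k : J (x k). Proof. exact: mem_ideal_span. Qed.

(** The initial form of x_k is regular on the graded ring of J over R/(x_U). Once a multiple x_k s0
    with s0 in J^n is split off, [colon_powers] with V the remaining indices applies to a - s0; its
    error term x_k^n already lies in J^n. *)
Let colon_H U n k : k \notin U -> colon (H U n.+1) (x k) = H U n.
Proof.
move=> kU; apply/seteqP; split=> a; last first.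
  move=> /ideal_addP[q [s [Qq Js ->]]]; rewrite /colon /= mulrDr.
  by apply: mem_ideal_add; [apply: ideal_mull|apply: mem_idealM].
move=> /ideal_addP[q [s [Qq Js eq_xa]]].
pose V := ~: (k |: U); pose L := ideal_span x (~: [set k]%SET).
have LJ : L `<=` J by apply: ideal_spanS; apply: finset.subsetT.
have JL : J `<=` ideal_adj L (x k).
  move=> u Ju; apply: ideal_spanU1; rewrite (_ : _ |: _ = finset.setT) //.
  by apply/setP => v; rewrite !inE orbN.
have LUV : L `<=` ideal_add (ideal_span x U) (ideal_span x V).
  apply: subset_trans (@ideal_spanU _ _ _ _ _); apply: ideal_spanS.
  by apply/fintype.subsetP => v; rewrite !inE negb_or => ->; rewrite orbN.
have [s0 Js0 /(idealX_ideal_add (iQ U) (iQ V) LUV)/ideal_addP[q' [t [Qq' Vt eq_s]]]] :=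
  idealX_ideal_adj iJ LJ JL Js.
have kV : k \notin V by rewrite !inE eqxx.
have VU : ~: (k |: V) = U.
  apply/setP => v; rewrite !inE; case: eqVneq => [->|_] /=; last by rewrite negbK.
  by rewrite (negPf kU).
have VJ m : idealX (ideal_span x V) m `<=` idealX J m.
  by apply/idealXSS/ideal_spanS; apply: finset.subsetT.
have [r /ideal_addP[q2 [t2 []]]] : ideal_adj (G (fun=> 1%N) k V n.+1) (x k ^+ n) (a -
  s0).
  apply: colon_powers => //; rewrite mulrBr eq_xa -addrA eq_s addrA.
  apply: mem_ideal_add => //; rewrite VU; apply: (ideal_memD (ideal_ideal_span _ _));
    by rewrite (eq_ideal_span (x' := x)).
rewrite VU (eq_ideal_span (x' := x)) => [Qq2 Vt2 eq_a|v _]; last exact: expr1.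
have -> : a = q2 + (t2 + s0 + x k ^+ n * r).
  by rewrite addrA addrA -eq_a; ring.
apply: mem_ideal_add => //; apply: (ideal_memD (iJX n)).
  by apply: (ideal_memD (iJX n)) => //; apply: VJ; apply: idealXS_sub.
by apply: (ideal_mulr _ (iJX n)); apply: mem_idealX.
Qed.

Let adj_H U n k : ideal_adj (H U n) (x k) = H (k |: U) n.
Proof.
have UkU : ideal_span x U `<=` ideal_span x (k |: U).
  exact/ideal_spanS/finset.subsetUr.
apply/seteqP; split.
  apply: ideal_adj_sub => //.
    exact: ideal_addSS.
  apply: ideal_addl => //; apply: mem_ideal_span; exact: finset.setU11.
apply: ideal_add_sub; first exact: ideal_ideal_adj.
  apply: ideal_span_sub; first exact: ideal_ideal_adj.
  move=> u /finset.setU1P[->|Uu]; first exact: mem_ideal_adj.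
  by apply: sub_ideal_adj => //; apply: ideal_addl => //; apply: mem_ideal_span.
by apply: subset_trans (sub_ideal_adj _ _) => //; apply: ideal_addr.
Qed.

Hypothesis fin_powers : forall n, fin_length (idealX J n : set R^o) setT.

Let fin_H U n : fin_length (H U n : set R^o) setT.
Proof.
have JH : idealX J n `<=` H U n by apply: ideal_addr.
by apply: fin_length_sub (fin_powers n) => //; apply: iH.
Qed.

(** Lengths in the exact sequence given by multiplication by x_k on R/H; the colon ideal lowers the
    power of J by one. *)
Let ell_H U n k : k \notin U ->
  ell (H U n.+1) setT = (ell (H U n) setT + ell (H (k |: U) n.+1) setT)%N.
Proof.
move=> kU; rewrite -adj_H -(colon_H n kU) ell_colon //.
have iA : ideal (ideal_adj (H U n.+1) (x k)) by apply: ideal_ideal_adj.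
have HA : H U n.+1 `<=` ideal_adj (H U n.+1) (x k) by apply: sub_ideal_adj.
by apply: lengthD => //; apply: iH.
Qed.

Let H1 U : H U 1 = J.
Proof.
apply/seteqP; split.
  apply: ideal_add_sub => //; last exact: idealM_subl.
  by apply: ideal_spanS; apply: finset.subsetT.
move=> a Ja; apply: ideal_addr => //; rewrite -[a]mulr1; exact: mem_idealM.
Qed.

(* The graded ring of J is a polynomial ring over R/J; its Hilbert function is
   computed by killing the x_k one at a time. *)
Lemma ell_idealX_span n :
  ell (idealX J n.+1) setT = ('C(n + d, d) * ell J setT)%N.
Proof.
suff ellH r U : #|~: U| = r -> forall n,
    ell (H U n.+1) setT = ('C(n + r, r) * ell J setT)%N.
  rewrite -(ellH d finset.set0) ?finset.setC0 ?cardsT ?card_ord //; congr ell.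
  apply/seteqP; split; first exact: ideal_addr.
  by apply: ideal_add_sub => // a /ideal_span0 ->; apply: ideal_mem0.
elim: r U {n} => [|r IHr] U Ur n.
  rewrite bin0 mul1n; congr ell; have -> : U = finset.setT.
    by rewrite -[U]finset.setCK (cards0_eq Ur) finset.setC0.
  apply/seteqP; split; last exact: ideal_addl.
  by apply: ideal_add_sub => //; apply: idealM_subl.
have /card_gt0P[k] : (0 < #|~: U|)%N by rewrite Ur.
rewrite inE => kU.
have kUr : #|~: (k |: U)| = r.
  apply/eqP; rewrite -eqSS -Ur (cardsD1 k (~: U)) inE kU add1n eqSS; apply/eqP.
  by congr #|pred_of_set _|; apply/setP => v; rewrite !inE negb_or.
(* [ell_H] turns into Pascal's rule; the recursion starts from H U 1 = J, whatever U is. *)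
elim: n => [|n IHn]; first by rewrite H1 binn mul1n.
by rewrite (ell_H n.+1 kU) IHn IHr // -mulnDl [in RHS]addSn binS addSnnS.
Qed.

End QuasiRegular.

(** * The leading coefficient of a Hilbert function as a limit *)

Lemma ffact_ge k d m : (m <= d)%N -> (k.+1 ^ m <= (k + d) ^_ m)%N.
Proof.
elim: m => // m IHm ltmd; rewrite expnSr ffactnSr leq_mul ?IHm ?(ltnW ltmd) //.
by rewrite ltn_subRL addnC ltn_add2l.
Qed.

Lemma ffact_le n m : (n ^_ m <= n ^ m)%N.
Proof. by elim: m => // m IHm; rewrite expnSr ffactnSr leq_mul ?leq_subr. Qed.

Lemma cvg_exp_harmonic (a l : rat) c d :
  ((fun k => (1 + a * harmonic (k + c)%N) ^+ d * l : rat^o) @ \oo --> (l : rat^o)).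
Proof.
have h0 : ((fun k => harmonic (k + c)%N : rat^o) @ \oo --> (0 : rat^o)).
  by rewrite (cvg_shiftn c (harmonic : nat -> rat^o)); apply: cvg_harmonic.
have h1 : ((fun k => 1 + a * harmonic (k + c)%N : rat^o) @ \oo --> (1 : rat^o)).
  suff : (fun k => 1 + a * harmonic (k + c)%N : rat^o) @ \oo --> (1 + a * 0 : rat^o).
    by rewrite mulr0 addr0.
  by apply: cvgD; [exact: cvg_cst|apply: cvgM; [exact: cvg_cst|exact: h0]].
have hd : (fun k => (1 + a * harmonic (k + c)%N) ^+ d : rat^o) @ \oo --> (1 : rat^o).
  elim: d => [|d IHd]; first exact: cvg_cst.
  under eq_fun do rewrite exprS.
  suff : (fun k => (1 + a * harmonic (k + c)%N) * (1 + a * harmonic (k + c)%N) ^+ d :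
    rat^o)
      @ \oo --> (1 * 1 : rat^o) by rewrite mulr1.
  exact: cvgM h1 IHd.
suff : (fun k => (1 + a * harmonic (k + c)%N) ^+ d * l : rat^o) @ \oo --> (1 * l :
  rat^o).
  by rewrite mul1r.
by apply: cvgM; [exact: hd|exact: cvg_cst].
Qed.

(* A function squeezed between two shifts of n |-> C(n + d, d) l has leading
   coefficient l / d`!. *)
Lemma lim_binomial (u : nat -> nat) c d l :
  (forall k, 'C(k + d, d) * l <= u (k + c.+1) <= 'C(k + c + d, d) * l)%N ->
  lim ((fun n : nat => (d`! * u n)%N%:R / n%:R ^+ d : rat^o) @ \oo) = l%:R.
Proof.
move=> u_le; apply: cvg_lim; first exact: norm_hausdorff.
rewrite -(cvg_shiftn c.+1).
(* With N = k + c + 1, the product d! C(k+d, d) is at least (k+1)^d = (N-c)^d, and d! C(k+c+d, d) is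
   at most (N+d)^d. Division by N^d gives the two bounding sequences. *)
apply: (squeeze_cvgr (f := fun k => (1 + - c%:R * harmonic (k + c)%N) ^+ d * l%:R)
    (h := fun k => (1 + d%:R * harmonic (k + c)%N) ^+ d * l%:R));
  [|exact: cvg_exp_harmonic|exact: cvg_exp_harmonic].
near=> k; have /andP[le_u u_le'] := u_le k.
have N_gt0 : 0 < (k + c.+1)%:R :> rat by rewrite ltr0n addnS.
have hE : harmonic (k + c)%N = (k + c.+1)%:R^-1 :> rat by rewrite /harmonic /= addnS.
have pE (a : rat) : (1 + a * harmonic (k + c)%N) ^+ d * l%:R
    = (((k + c.+1)%:R + a) ^+ d * l%:R) / (k + c.+1)%:R ^+ d.
  rewrite hE mulrAC -expr_div_n; congr (_ ^+ _ * _).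
  by rewrite mulrDl divff ?gt_eqF.
rewrite !pE !ler_pM2r ?invr_gt0 ?exprn_gt0 //; apply/andP; split.
  have -> : (k + c.+1)%:R + - c%:R = k.+1%:R :> rat by rewrite -addSnnS natrD addrK.
  rewrite -natrX -natrM ler_nat.
  apply: leq_trans (leq_mul (leqnn _) le_u).
  by rewrite mulnA (mulnC d`!) bin_ffact leq_mul // ffact_ge.
rewrite -natrD -natrX -natrM ler_nat.
apply: leq_trans (leq_mul (leqnn _) u_le') _.
rewrite mulnA (mulnC d`!) bin_ffact leq_mul //; apply: leq_trans (ffact_le _ _) _.
by case: (d) => // d'; rewrite leq_exp2r // leq_add2r leq_add2l.
Unshelve. all: by end_near.
Qed.

(** * The multiplicity computed from a reduction *)

Section Multiplicity.
Variables (R : comNzRingType).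
Implicit Types I J K m : set R.

Lemma ell_antitone I K : ideal I -> ideal K -> I `<=` K ->
  fin_length (I : set R^o) setT -> (ell K setT <= ell I setT)%N.
Proof.
by move=> iI iK IK finI; rewrite /ell (lengthD iI iK (ideal_setT R) IK) // leq_addl.
Qed.

(** The inclusions of I^(k+1+c) in J^(k+1) and of J^(k+c+1) in I^(k+c+1) squeeze the Hilbert
    function of I between two shifts of that of J, which is known exactly. *)
Lemma multiplicity_reduction d m I (x : 'I_d -> R) :
  noetherian R -> maximal_ideal m -> m `<=` radical (ideal_span x finset.setT) ->
  reduction (ideal_span x finset.setT) I ->
  (forall (e : 'I_d -> nat) j a,
    ideal_span (fun u => x u ^+ e u) (~: [set j]%SET) (x j * a) ->
    ideal_span (fun u => x u ^+ e u) (~: [set j]%SET) a) ->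
  multiplicity d I = (ell (ideal_span x finset.setT) setT)%:R.
Proof.
set J := ideal_span x _ => noeR maxm mJ [iJ JI [c red]] reg.
have finJ n : fin_length (idealX J n : set R^o) setT.
  apply: (fin_length_radical noeR maxm); first exact: idealX_ideal.
  by apply: subset_trans (@radical_idealX _ _ _).
have finI n : fin_length (idealX I n : set R^o) setT.
  apply: (fin_length_radical noeR maxm); first exact: idealX_ideal.
  by apply: subset_trans (@radical_idealX _ _ _); apply: subset_trans (radical_sub JI).
rewrite /multiplicity; apply: (@lim_binomial (fun n => ell (idealX I n) setT) c) => k.
rewrite -!(ell_idealX_span reg finJ) -/J; apply/andP; split.
  apply: ell_antitone; [exact: idealX_ideal|exact: idealX_ideal| |exact: finI].
  rewrite -addSnnS (reduction_idealX _ red); exact: iter_idealM_sub.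
rewrite addnS.
by apply: ell_antitone; [exact: idealX_ideal|exact: idealX_ideal|exact:
  idealXSS|exact: finJ].
Qed.

End Multiplicity.

(** * Lengths of the modules of the complex *)

Section KoszulLength.
Variables (R : comNzRingType) (d : nat).
Implicit Types (S : {set 'I_d}) (X : {set {set 'I_d}}) (a : koszul R d).

Definition koszul_eval S : koszul R d -> R^o := fun a => a S.

Fact koszul_eval_is_linear S : linear (koszul_eval S).
Proof. by move=> r a b; rewrite /koszul_eval !ffunE. Qed.

HB.instance Definition _ S := GRing.isLinear.Build R (koszul R d) R^o *:%R
  (koszul_eval S) (koszul_eval_is_linear S).

Lemma koszul_entries_submodule (I : {set 'I_d} -> set R) i : (forall S, ideal (I S)) ->
  submodule [set a : koszul R d | koszul_deg i a /\ forall S, I S (a S)].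
Proof.
move=> iI; split.
- split; first by move=> S _; rewrite ffunE.
  by move=> S; rewrite ffunE; apply: (ideal_mem0 (iI S)).
- move=> a b [ai Ia] [bi Ib]; split; first exact: koszul_degD.
  by move=> S; rewrite ffunE; apply: (ideal_memD (iI S)).
- move=> r a [ai Ia]; split; first exact: koszul_degZ.
  by move=> S; rewrite ffunE; apply: (ideal_mull _ (iI S)).
Qed.

(** In the filtration [E X] the entries indexed by X are free and the others are confined to I.
    Freeing one more entry S adds a factor R/I, through evaluation at S. *)
Lemma is_length_koszul_deg (I : set R) i l : ideal I -> is_length (I : set R^o) setT l
  ->
  is_length [set a : koszul R d | koszul_deg i a /\ forall S, I (a S)] (@koszul_deg R
    d i)
    ('C(d, i) * l)%N.
Proof.
move=> iI lI; pose F X S : set R := if S \in X then setT else I.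
have iF X S : ideal (F X S) by rewrite /F; case: ifP.
pose E X := [set a : koszul R d | koszul_deg i a /\ forall S, F X S (a S)].
have sE X : submodule (E X) by apply: koszul_entries_submodule.
have E0 : E finset.set0 = [set a | koszul_deg i a /\ forall S, I (a S)].
  by apply/seteqP; split=> a [ai Ia]; split=> // S; have := Ia S; rewrite /F inE.
pose Xi := [set S : {set 'I_d} | #|S| == i]%SET.
have EXi : E Xi = @koszul_deg R d i.
  apply/seteqP; split=> [a []//|a ai]; split=> // S; rewrite /F inE.
  by case: ifPn => // Si; rewrite ai //; apply: ideal_mem0.
have cardXi : #|Xi| = 'C(d, i).
  by rewrite -[d in RHS]card_ord -card_draws; apply: eq_card => S; rewrite !inE.
(* The generalized X has to stay inside [Xi]: at subsets of another size the entries vanish and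
   would add no length. *)
rewrite -E0 -EXi -cardXi; have: Xi \subset Xi by [].
move: {1 3 4}Xi => X; move: {2}#|X| (erefl #|X|) => n.
elim: n X => [|n IHn] X Xn sub.
  by rewrite Xn mul0n (cards0_eq Xn); apply: fin_length_refl.
have /card_gt0P[S XS] : (0 < #|X|)%N by rewrite Xn.
have X'n : #|X :\ S| = n by apply/eqP; rewrite -eqSS -Xn (cardsD1 S X) XS.
have subF T : F (X :\ S) T `<=` F X T.
  by rewrite /F !inE; case: (T \in X); rewrite ?andbT ?andbF.
have subE : E (X :\ S) `<=` E X.
  by move=> a [ai Fa]; split=> // T; apply: subF.
rewrite Xn mulSn addnC -X'n.
apply: (is_lengthD (B := E (X :\ S))) => //; last first.
- apply/(is_length_iso (f := koszul_eval S) (A' := I : set R^o) (B' := setT)) => //.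
    move=> a [ai Fa]; split=> [[_ /(_ S)]|Ia]; first by rewrite /F !inE eqxx.
    split=> // T; have := Fa T; rewrite /F !inE.
    by case: eqVneq => [->|_] //=; rewrite XS.
  move=> r _; exists [ffun T => if T == S then r else 0].
    split=> [T Ti|T]; rewrite ffunE; last first.
      by case: eqP => [->|_]; [rewrite /F XS|apply: (ideal_mem0 (iF X T))].
    case: eqP => // TS; have := fintype.subsetP sub S XS.
    by rewrite inE -TS (negPf Ti).
  by rewrite /= /koszul_eval ffunE eqxx subrr; apply: ideal_mem0.
- apply: IHn => //; apply: fintype.subset_trans sub; exact: finset.subsetDl.
- by move=> a [ai Ia]; split=> // T; have := Ia T; rewrite /F !inE; case: ifP.
Qed.

End KoszulLength.

(** * The alternating sum of the lengths of the homology of C(1,1) *)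

Section EulerCharacteristic.
Variables (R : comNzRingType) (d : nat) (I1 I2 : set R) (x : 'I_d -> R).
Hypotheses (iI1 : ideal I1) (xI2 : forall j, I2 (x j)).
Hypothesis finI1 : fin_length (I1 : set R^o) setT.

Let K i : set (koszul R d) := @koszul_deg R d i.
Let D i : set (koszul R d) := @c11_den R d I1 I2 i.
Let Z i : set (koszul R d) := @c11_cycles R d I1 I2 x i.
Let B i : set (koszul R d) := @c11_boundaries R d I1 I2 x i.

Let iI i : ideal (if i is 0%N then idealM I1 I2 else I1).
Proof. by case: i => //; apply: idealM_ideal. Qed.

Let sK i : submodule (K i). Proof. exact: submodule_koszul_deg. Qed.

Let sD i : submodule (D i).
Proof. by apply: (koszul_entries_submodule (I := fun=> _)) => _; apply: iI. Qed.

Let sB i : submodule (B i).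
Proof.
split=> [|_ _ [a Ka [b Db <-]] [a' Ka' [b' Db' <-]]|r _ [a Ka [b Db <-]]].
- exists 0; first exact: (submodule0 (sK _)).
  by exists 0; [exact: (submodule0 (sD _))|rewrite linear0 addr0].
- exists (a + a'); first exact: (submoduleD (sK _)).
  by exists (b + b'); [exact: (submoduleD (sD _))|rewrite linearD addrACA].
- exists (r *: a); first exact: (submoduleZ _ (sK _)).
  by exists (r *: b); [exact: (submoduleZ _ (sD _))|rewrite linearZ scalerDr].
Qed.

Let sZ i : submodule (Z i).
Proof.
apply: submoduleI => //; split=> [|a b|r a] /=.
- by rewrite linear0; apply: (submodule0 (sD _)).
- by rewrite linearD; apply: (submoduleD (sD _)).
- by rewrite linearZ; apply: (submoduleZ _ (sD _)).
Qed.

Let DB i : D i `<=` B i.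
Proof.
move=> a Da; exists 0; first exact: (submodule0 (sK _)).
by exists a => //; rewrite linear0 add0r.
Qed.

Let BK i : B i `<=` K i.
Proof.
by move=> _ [a Ka [b [Kb _] <-]]; apply: (submoduleD (sK i)) => //;
  apply: koszul_diff_deg.
Qed.

(** This makes the Koszul differential descend to C(1,1); into degree 0 it uses that x_j lies in I2,
    so that I1 x_j is inside I1 I2. *)
Let diff_D i a : D i.+1 a -> D i (koszul_diff x a).
Proof.
move=> [Ka Ia]; split; first exact: koszul_diff_deg.
move=> S; have := iI i; set I := (if i is 0%N then _ else _) => iIi.
rewrite ffunE; apply: (submodule_sum (N := I : set R^o)) => // j _.
have Iaj : I1 (a (j |: S)) by apply: Ia.
rewrite /I -mulrA; apply: (ideal_mull _ iIi); rewrite /I; case: (i).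
  by rewrite mulrC; apply: mem_idealM.
by move=> _; apply: (ideal_mull _ iI1).
Qed.

Let BZ i : (0 < i)%N -> B i `<=` Z i.
Proof.
case: i => // i _ a Ba; split; first exact: BK.
case: Ba => b Kb [c Dc <-]; rewrite /= linearD /= koszul_diff_diff add0r; exact: diff_D.
Qed.

Let ZK i : Z i `<=` K i. Proof. by move=> a []. Qed.

Let L1 := ell I1 setT.

Let lenKD i : (0 < i)%N -> is_length (D i) (K i) ('C(d, i) * L1)%N.
Proof. by case: i => // i _; apply: is_length_koszul_deg => //; apply: fin_lengthP. Qed.

Let b i : nat := length (D i) (B i).

(** The differential maps K_1 onto J, and the preimage of I1 J is B_1: if a is sent to the sum of
    the c_j x_j with c_j in I1, then a minus the sum of the c_j e_j is a cycle, hence a boundary. So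
    K_1/B_1 is isomorphic to J/I1 J. *)
Lemma length_koszul_deg1 : koszul_exact_mod x [set 0] 1 ->
  (d * L1 = b 1 + length (idealM I1 (ideal_span x finset.setT) : set R^o)
                         (ideal_span x finset.setT))%N.
Proof.
move=> ex1; have lK := lenKD (ltn0Sn 0).
rewrite -[in LHS](bin1 d) -(is_length_length lK).
rewrite (lengthD (sD 1) (sB 1) (sK 1) (@DB 1) (@BK 1));
  last by exists ('C(d, 1) * L1)%N.
congr (_ + _)%N; set J := ideal_span x finset.setT.
have iJ : ideal J by apply: ideal_ideal_span.
have evalE a : K 1 a -> koszul_eval finset.set0 (koszul_diff x a)
    = \sum_j a [set j]%SET * x j.
  by move=> a1; rewrite /koszul_eval koszul_diff1 // cards0.
apply: (length_iso (f := koszul_eval finset.set0 \o koszul_diff x)) => //=.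
- exact: idealM_ideal.
- exact: idealM_subr.
- move=> a a1; rewrite evalE //; exists (fun j => a [set j]%SET).
  by apply: eq_bigl => j; rewrite inE.
- move=> a a1; split=> [[w Kw [c [Kc Ic] eq_a]]|].
    have -> : koszul_diff x a = koszul_diff x c.
      by rewrite -eq_a linearD /= koszul_diff_diff add0r.
    rewrite evalE //; have iM := idealM_ideal I1 J.
    apply: (submodule_sum (N := idealM I1 J : set R^o)) => // j _.
    by apply: mem_idealM; [exact: Ic|exact: mem_ideal_span].
  rewrite evalE // => /(idealM_ideal_span iI1)[c Ic eq_c].
  have cK : K 1 (koszul1 c) by apply: koszul1_deg.
  have dK : K 1 (a - koszul1 c) by apply: (submoduleB (sK _)).
  have [|w Kw dw] := ex1 _ dK.
    move=> S; rewrite koszul_diff1 //; case: ifP => // _; rewrite -evalE //.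
    rewrite !linearB /= !evalE // eq_c; apply/eqP; rewrite subr_eq0; apply/eqP.
    by apply: eq_bigr => j _; rewrite koszul1E.
  exists w => //; exists (koszul1 c).
    split=> // S; rewrite ffunE; case: pickP => // _; exact: ideal_mem0.
  have /eqP : a - koszul1 c - koszul_diff x w = 0.
    by apply/ffunP => S; rewrite dw ffunE.
  by rewrite subr_eq0 subr_eq => /eqP ->.
- move=> r [c ->]; exists (koszul1 c); first exact: koszul1_deg.
  rewrite evalE; last exact: koszul1_deg.
  rewrite (_ : _ - _ = 0); first exact: (ideal_mem0 (idealM_ideal _ _)).
  apply/eqP; rewrite subr_eq0; apply/eqP.
  by apply: eq_big => [j|j _]; rewrite ?inE // koszul1E.
Qed.

(** Additivity along D_i, B_i, Z_i, K_i; the differential identifies the top factor K_i/Z_i with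
    B_(i-1)/D_(i-1). *)
Lemma length_koszul_deg i : (1 < i)%N ->
  ('C(d, i) * L1 = b i.-1 + h11 I1 I2 x i + b i)%N.
Proof.
move=> i_gt1; have i_gt0 : (0 < i)%N := ltnW i_gt1.
have lK := lenKD i_gt0; have finK : fin_length (D i) (K i) by exists ('C(d, i) * L1)%N.
have finZ : fin_length (D i) (Z i).
  apply: fin_length_sub finK => //; apply: subset_trans (BZ i_gt0); exact: DB.
rewrite -(is_length_length lK).
rewrite (lengthD (sD i) (sZ i) (sK i) _ (@ZK i) finK); last first.
  by apply: subset_trans (BZ i_gt0); exact: DB.
rewrite (lengthD (sD i) (sB i) (sZ i) (@DB i) (BZ i_gt0) finZ).
have -> : length (Z i) (K i) = b i.-1.
  apply: (length_iso (f := koszul_diff x)) => //.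
  - move=> a Ka; exists a; first by rewrite prednK.
    by exists 0; [exact: (submodule0 (sD _))|rewrite addr0].
  - by move=> a Ka; split=> [[]|].
  - move=> _ [a Ka [c Dc <-]]; exists a; first by rewrite prednK in Ka.
    by rewrite addrAC subrr add0r.
by rewrite addnC (addnC (length _ _)) addnA.
Qed.

Lemma sum_h11 : (0 < d)%N ->
  \sum_(2 <= i < d.+1) (-1) ^+ i * ((h11 I1 I2 x i)%:R - 'C(d, i)%:R * L1%:R)
    = - (b 1)%:R :> rat.
Proof.
move=> d_gt0.
have b_d : b d = 0%N.
  rewrite /b (_ : B d = D d); first exact/is_length_length/fin_length_refl.
  apply/seteqP; split=> // _ [a Ka [c Dc <-]].
  by rewrite (koszul_deg_gt (ltnSn d) Ka) linear0 add0r.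
(* The i-th term is -(-1)^i (b_(i-1) + b_i), so the partial sum up to n retains only its two
   ends. *)
suff H n : (0 < n)%N -> \sum_(2 <= i < n.+1)
    (-1) ^+ i * ((h11 I1 I2 x i)%:R - 'C(d, i)%:R * L1%:R)
    = - (b 1)%:R - (-1) ^+ n * (b n)%:R :> rat.
  by rewrite H // b_d mulr0 subr0.
case: n => // n _; elim: n => [|n IHn].
  by rewrite big_geq // expr1 mulN1r opprK addNr.
rewrite big_nat_recr //= IHn -natrM length_koszul_deg // !natrD /= (exprS _ n.+1).
ring.
Qed.

End EulerCharacteristic.

(** * The length formula for a given reduction, and the two criteria *)

Lemma reduction_radical (R : comNzRingType) (I J : set R) :
  reduction J I -> radical I `<=` radical J.
Proof.
move=> [iJ JI [n red]]; apply: subset_trans (@radical_idealX _ _ n.+1) _.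
by apply: radical_sub; rewrite -red; apply: idealM_subl.
Qed.

(* The length of R/I1 J is both l(J/I1 J) + l(R/J) and
   l(I1 I2/I1 J) + l(R/I1 I2). *)
Lemma multiplicity_sum_h11 (R : comNzRingType) (m : set R) (d : nat)
    (I1 I2 : set R) (x : 'I_d -> R) :
  noetherian R -> is_local m -> cohen_macaulay m d -> (1 <= d)%N ->
  is_primary_to m I1 -> is_primary_to m I2 ->
  reduction (ideal_span x finset.setT) I2 ->
  fin_length (idealM I1 (ideal_span x finset.setT) : set R^o) (idealM I1 I2) /\
  multiplicity d I2 - (ell (idealM I1 I2) setT)%:R + d%:R * (ell I1 setT)%:R
    = (length (idealM I1 (ideal_span x finset.setT) : set R^o) (idealM I1 I2))%:R
      - \sum_(2 <= i < d.+1) (-1) ^+ i *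
           ((h11 I1 I2 x i)%:R - 'C(d, i)%:R * (ell I1 setT)%:R).
Proof.
set J := ideal_span x _.
move=> noeR [maxm _] [_ [[ys [reg_ys ys_m sz_ys]] _]] d_gt0.
move=> [[iI1 _ _] rI1] [[iI2 _ _] rI2] red.
have [iJ JI2 _] := red.
have mJ : m `<=` radical J by rewrite -rI2; apply: reduction_radical.
have fin I : ideal I -> m `<=` radical I -> fin_length (I : set R^o) setT.
  exact: fin_length_radical noeR maxm.
(* Stated for any family whose radical contains the x_u, to cover x and its powers alike: the
   regular sequence supplied by the depth lies in m, hence in the radical of (x'). *)
have ex1 (x' : 'I_d -> R) : (forall u, radical (ideal_span x' finset.setT) (x u)) ->
    koszul_exact_mod x' [set 0] 1.
  move=> rx; apply: (koszul_exact sz_ys reg_ys) => // y /ys_m/mJ Jy.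
  have ir := ideal_radical (ideal_ideal_span x' finset.setT).
  apply: radical_radical; apply: radical_sub Jy.
  by apply: ideal_span_sub => // u _; apply: rx.
have reg (e : 'I_d -> nat) j a :
    ideal_span (fun u => x u ^+ e u) (~: [set j]%SET) (x j * a) ->
    ideal_span (fun u => x u ^+ e u) (~: [set j]%SET) a.
  (* The j-th element keeps exponent 1, since x_j itself is to be regular; e_j does not occur in the
     span over the complement of j. *)
  pose x' u := if u == j then x u else x u ^+ e u.
  have ex' : koszul_exact_mod x' [set 0] 1.
    apply: ex1 => u; have xu : ideal_span x' finset.setT (x' u) by apply:
      mem_ideal_span.
    by move: xu; rewrite {2}/x'; case: ifP => _ xu; [exists 1%N|exists (e u)].
  rewrite (eq_ideal_span (x' := x')) => [|u]; last by rewrite /x' !inE => /negPf ->.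
  have {1}-> : x j = x' j by rewrite /x' eqxx.
  exact: koszul_exact_regular.
have ex : koszul_exact_mod x [set 0] 1.
  by apply: ex1 => u; apply: sub_radical; apply: mem_ideal_span.
have finI1 : fin_length (I1 : set R^o) setT by apply: fin => //; rewrite rI1.
have iM I : ideal (idealM I1 I) by apply: idealM_ideal.
have sub12 : idealM I1 J `<=` idealM I1 I2 by apply: idealMSS.
have finM : fin_length (idealM I1 J : set R^o) setT.
  apply: fin => // a ma; apply: radical_idealM; last exact: mJ.
  by rewrite rI1.
split; first exact: (fin_length_sub (iM J) (@subset_refl _ _) sub12 (@subsetT _ _)
  finM).
have xI2 j : I2 (x j) by apply: JI2; apply: mem_ideal_span.
have eqd := length_koszul_deg1 I2 iI1 finI1 ex.
have eq1 : (ell (idealM I1 J) setT = length (idealM I1 J : set R^o) J + ell J setT)%N.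
  exact: (lengthD (iM J) iJ (@ideal_setT R) (@idealM_subr _ I1 J iJ) (@subsetT _ J)
    finM).
have eq2 : (ell (idealM I1 J) setT =
    length (idealM I1 J : set R^o) (idealM I1 I2) + ell (idealM I1 I2) setT)%N.
  exact: (lengthD (iM J) (iM I2) (@ideal_setT R) sub12 (@subsetT _ _) finM).
rewrite (multiplicity_reduction noeR maxm mJ red reg) -/J.
rewrite (sum_h11 iI1 xI2 finI1 d_gt0) opprK -natrM eqd.
move: eq1; rewrite eq2 => /(congr1 (fun n => n%:R : rat)); rewrite !natrD => eqr.
by rewrite -/J; lra.
Qed.

Theorem lemma3p2 (R : comNzRingType) (m : set R) (d : nat) (I1 I2 : set R)
  (R_noetherian : noetherian R) (R_local : is_local m)
  (R_CM : cohen_macaulay m d) (d_ge1 : (1 <= d)%N)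
  (residue_infinite : infinite_residue_field m)
  (I1_primary : is_primary_to m I1) (I2_primary : is_primary_to m I2) :
  (minimal_multiplicity d I1 I2 <->
   exists2 x : 'I_d -> R, minimal_reduction (ideal_gen (range x)) I2 &
     multiplicity d I2 - (ell (idealM I1 I2) setT)%:R
       + d%:R * (ell I1 setT)%:R
     = - \sum_(2 <= i < d.+1) (-1) ^+ i *
           ((h11 I1 I2 x i)%:R - 'C(d, i)%:R * (ell I1 setT)%:R)) /\
  (almost_minimal_multiplicity d I1 I2 <->
   exists2 x : 'I_d -> R, minimal_reduction (ideal_gen (range x)) I2 &
     multiplicity d I2 - (ell (idealM I1 I2) setT)%:R
       + d%:R * (ell I1 setT)%:R
     = 1 - \sum_(2 <= i < d.+1) (-1) ^+ i *
           ((h11 I1 I2 x i)%:R - 'C(d, i)%:R * (ell I1 setT)%:R)).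
Proof.
(* For a fixed x one equivalence serves both claims, with n = 0 and n = 1. Going back from the
   equation to [is_length] requires the finiteness of the length, as the value 0 of [length] alone
   could be the default. *)
have lenP (x : 'I_d -> R) : minimal_reduction (ideal_gen (range x)) I2 -> forall n :
  nat,
    is_length (idealM I1 (ideal_gen (range x)) : set R^o) (idealM I1 I2) n <->
    multiplicity d I2 - (ell (idealM I1 I2) setT)%:R + d%:R * (ell I1 setT)%:R
    = n%:R - \sum_(2 <= i < d.+1) (-1) ^+ i *
         ((h11 I1 I2 x i)%:R - 'C(d, i)%:R * (ell I1 setT)%:R).
  rewrite ideal_gen_range => -[red _] n.
  have [fin ->] := multiplicity_sum_h11 R_noetherian R_local R_CM d_ge1
    I1_primary I2_primary red.
  split=> [ln|/addIr/eqP]; first by rewrite (is_length_length ln).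
  by rewrite eqr_nat => /eqP <-; apply: fin_lengthP.
split; split=> -[x redx eqx]; exists x => //.
- by rewrite (lenP x redx 0%N).1 // sub0r.
- by apply/(lenP x redx); rewrite sub0r.
- exact: (lenP x redx 1%N).1.
- exact/(lenP x redx 1%N).
Qed.
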